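(* Let $\mathcal{F}=\{F_1,\dots,F_k\}\subset\mathbb{Z}[n]$ be a system of one-variable polynomials of degree at least $1$, each irreducible over $\mathbb{Q}$ and without multiple roots, such that the product $F=F_1\cdots F_k$ has exactly $\sum_{i=1}^k\deg F_i$ distinct roots in $\overline{\mathbb{Q}}$. Then $$\ln T(q)=O\left(\frac{1}{\log q}\right)\qquad(q\to\infty),$$ where $T(q)=\prod_{p>q}L_p$ is the tail of the singular product of $\mathcal{F}$ and the implied constant may depend on $\mathcal{F}$.
   Context: For a prime $p$, $\nu(p)=\#\{n \bmod p : p\mid F_1(n)\cdots F_k(n)\}$ and the local factor is $L_p=\dfrac{1-\nu(p)/p}{(1-1/p)^k}$. The tail is $T(q)=\prod_{p>q}L_p$, with $\ln T(q)=\sum_{p>q}\ln L_p$; products and sums over primes are taken in increasing order of $p$ (limit of the partial products or sums over $q<p\le x$ as $x\to\infty$). For all sufficiently large $p$ one has $L_p>0$, so $\ln T(q)$ is considered for sufficiently large $q$. *)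

(* Defs.v *)
From mathcomp Require Import all_boot all_order all_algebra.
From mathcomp Require Import all_classical all_reals all_analysis.
Import Order.TTheory GRing.Theory Num.Theory.
Import numFieldNormedType.Exports.

Set Implicit Arguments.
Unset Strict Implicit.
Unset Printing Implicit Defensive.

Local Open Scope classical_set_scope.
Local Open Scope ring_scope.

(* Residue classes mod p are represented by 0, ..., p - 1; p is a natural
   number, and only its values at primes are used. *)
Definition nu (k : nat) (F : 'I_k -> {poly int}) (p : nat) : nat :=
  #|[pred n : 'I_p | (p%:Z %| \prod_(i < k) (F i).[n%:Z])%Z]|.

Definition local_factor (R : realType) (k : nat) (F : 'I_k -> {poly int})
    (p : nat) : R :=
  (1 - (nu F p)%:R / p%:R) / (1 - p%:R^-1) ^+ k.

Definition tail_prod (R : realType) (k : nat) (F : 'I_k -> {poly int})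
    (q : R) (x : nat) : R :=
  \prod_(0 <= p < x.+1 | prime p && (q < p%:R)) local_factor R F p.

Definition tail_log_sum (R : realType) (k : nat) (F : 'I_k -> {poly int})
    (q : R) (x : nat) : R :=
  \sum_(0 <= p < x.+1 | prime p && (q < p%:R)) ln (local_factor R F p).

(* lim is total: this is meaningful only where the partial products converge. *)
Definition tail (R : realType) (k : nat) (F : 'I_k -> {poly int}) (q : R) : R :=
  limn (tail_prod F q).

(* Lets the Landau notation =O_ be used at +oo. *)
Canonical pinfty_filter_on (R : numFieldType) :=
  FilterType (pinfty_nbhs R) (@filter_filter R _ proper_pinfty_nbhs).

(* Main.v *)
Require Import Defs.
From mathcomp Require Import all_boot all_order all_algebra all_field.
From mathcomp Require Import all_classical all_reals all_analysis.
From mathcomp Require Import perm zify ring lra.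
Import Order.TTheory GRing.Theory Num.Theory.
Import numFieldNormedType.Exports.

Set Implicit Arguments.
Unset Strict Implicit.
Unset Printing Implicit Defensive.

Local Open Scope classical_set_scope.
Local Open Scope card_scope.
Local Open Scope ring_scope.

(** Write [nu p] for the number of roots of the system modulo [p].  As
[ln L_p = (k - nu p) / p + O(1 / p ^ 2)], the tail is governed by the sums of
[(nu p - k) / p], and summation by parts ([abel_sum_le]) reduces the theorem to
the boundedness of the partial sums of [ln p * (nu p - k) / p] ([nu_mean]).
Since the product has as many roots as its degree allows, the members of the
system are pairwise coprime ([system_coprime]), so for large [p] the number [nu p]
is the sum of the numbers of roots of the members ([nu_sum_nroots]).  What remains
is a theorem of Nagell ([nagell]): for irreducible [f], the sum over [p <= N] of
[ln p / p] times the number of roots of [f] modulo [p] is [ln N + O(1)].  Mertens'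
theorem is the case [f = 'X].

Nagell's theorem is proved without ideal theory, by factoring the norms of the
elements of Z[X]/(f), for [f] monic of degree [d], with coordinates in a box of
side [y]; to avoid the bad primes, only elements congruent to 1 modulo a fixed
integer are used.  The norm of an element is the determinant of the matrix of its
multiplication ([nform]).  Its size is of order [y ^ d], and the sum over the box
of the logarithms of the norms is [y ^ d * (d * ln y + O(1))]: for the lower bound,
the norm is a monic polynomial on lines parallel to the first axis, and a monic
polynomial takes few small values ([sum_ln_nform_ge]).

The same sum is the sum over [p] of [ln p] times the total valuation at [p].  The
valuation of a norm is the number of common roots of [f] and the element modulo
[p], up to the contribution of divisibility by [p ^ j] with [j >= 2]
([dvd_nform_ncommon], [logn_nform_le]).

- Divisibility by [p ^ j] is rare: such elements fall into [d ^ j] classes within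
  which differences have the same divisibility ([krylov_det_classes]).  A nonzero
  norm divisible by [p ^ j] is at least [p ^ j], so two elements of a class are
  never in the same cell of side about [p ^ (j / d)], and there are about
  [y ^ d / p ^ j] cells.

- Having a given root modulo [p] has the expected frequency [1 / p]: the lattice
  of the elements with that root is closed under multiplication by ['X], so one
  short vector of it provides a whole short basis ([short_representative]).  Hence
  any two residues differ by a short vector, and a translation by it changes the
  count only near the faces of the box ([count_residue_le]).

The errors sum to [O(y ^ d)] over the primes up to the order of magnitude
[y ^ d], by Chebyshev's bound ([prime_sum_le]); the comparison of the two
evaluations is [nagell_scale]. *)

(** * Integer matrices modulo a prime *)

Lemma Fp_intr_eq0 (p : nat) (z : int) :
  prime p -> (z%:~R == 0 :> 'F_p) = (p %| z)%Z.
Proof. by move=> pp; rewrite (dvdz_pcharf (pchar_Fp pp)). Qed.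

Lemma Fp_lift (p : nat) (x : 'F_p) : ((nat_of_ord x)%:Z)%:~R = x.
Proof. by rewrite -pmulrn natr_Zp. Qed.

Lemma Fp_ord_inj (p : nat) :
  prime p -> injective (fun r : 'I_p => (r%:Z)%:~R : 'F_p).
Proof.
move=> pp r r' /eqP; rewrite -subr_eq0 -intrB Fp_intr_eq0 // => pr.
apply: val_inj => /=; have := ltn_ord r; have := ltn_ord r'.
move: pr; rewrite -eqz_mod_dvd => /eqP; rewrite !modz_nat => -[].
by move=> + h1 h2; rewrite !modn_small.
Qed.

Lemma prime_dvdn_fact (p n : nat) : prime p -> (p %| n`!)%N = (p <= n)%N.
Proof.
move=> pp; apply/idP/idP => [|pn]; last by apply: dvdn_fact; rewrite prime_gt0.
elim: n => [|n IH]; first by rewrite dvdn1 => /eqP p1; rewrite p1 in pp.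
by rewrite factS Euclid_dvdM // => /orP[/dvdn_leq -> //|/IH /leqW //].
Qed.

Lemma leq_absz_sum (I : finType) (F : I -> int) :
  (`|(\sum_i F i)%R| <= \sum_i `|F i|)%N.
Proof. by elim/big_ind2: _ => // x1 x2 y1 y2; lia. Qed.

(** Modulo [p], row operations clear all but [rank A] rows; lifted to integers
they make all the other rows divisible by [p]. *)
Lemma dvdz_det_corank (n p : nat) (A : 'M[int]_n) : prime p ->
  ((p ^ (n - \rank (map_mx intr A : 'M['F_p]_n)))%N %| \det A)%Z.
Proof.
move=> pp; set Ab := map_mx _ _; set r := \rank Ab.
pose lft (x : 'F_p) : int := (nat_of_ord x)%:Z.
pose P := map_mx lft (invmx (col_ebase Ab)).
have mapP : map_mx intr P = invmx (col_ebase Ab).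
  by apply/matrixP => i j; rewrite !mxE Fp_lift.
have detP : coprimez (p ^ (n - r))%N (\det P).
  rewrite coprimezE /= coprimeXl // prime_coprime //.
  have := Fp_intr_eq0 (\det P) pp; rewrite dvdzE /= => <-.
  by rewrite -det_map_mx mapP -unitfE -unitmxE unitmx_inv col_ebase_unit.
suff : ((p ^ (n - r))%N %| \det (P *m A))%Z by rewrite det_mulmx Gauss_dvdzr.
pose A' := P *m A.
have A'0 (i j : 'I_n) : (r <= i)%N -> (p %| A' i j)%Z.
  move=> ri; rewrite -Fp_intr_eq0 //.
  have -> : (A' i j)%:~R = (map_mx intr A' : 'M['F_p]_n) i j by rewrite [RHS]mxE.
  rewrite map_mxM /= mapP -/Ab -[X in _ *m X]mulmx_ebase -mulmxA mulKmx ?col_ebase_unit //.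
  rewrite mxE big1 // => l _; rewrite !mxE.
  by rewrite ltnNge ri andbF mul0r.
pose dg : 'rV[int]_n := \row_i (if (i < r)%N then 1 else p%:Z).
pose B := \matrix_(i < n, j < n) (if (i < r)%N then A' i j else (A' i j %/ p)%Z).
have -> : P *m A = diag_mx dg *m B.
  rewrite -/A' mul_diag_mx; apply/matrixP => i j.
  rewrite [RHS]mxE [dg 0 i]mxE [B i j]mxE.
  by case: ltnP => ri; rewrite ?mul1r // mulrC divzK // A'0.
rewrite det_mulmx det_diag; apply: dvdz_mulr.
suff -> : \prod_i dg 0 i = (p ^ (n - r))%N%:Z by [].
under eq_bigr => i _ do rewrite mxE.
rewrite (bigID (fun i : 'I_n => (i < r)%N)) /= big1 ?mul1r; last by move=> i ->.
rewrite (eq_bigr (fun=> p%:Z)); last by move=> i /negbTE ->.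
rewrite prodr_const -[RHS]natz natrX natz; congr (_ ^+ _).
rewrite -sum1_card.
rewrite (eq_bigl (fun i : 'I_n => (r <= i)%N)); last by move=> i; rewrite /= leqNgt.
rewrite -(big_mkord (fun i => (r <= i)%N) (fun=> 1%N)).
have rn : (r <= n)%N by apply: rank_leq_row.
rewrite (big_cat_nat (leq0n r) rn) //= big_nat_cond big_pred0 ?add0n; last first.
  by move=> i; lia.
rewrite big_nat_cond (eq_bigl (fun i => (r <= i < n)%N)); last first.
  by move=> i; lia.
by rewrite -big_nat sum_nat_const_nat muln1.
Qed.

(** * Sublattices and Krylov matrices *)

(** Reduction of [w] modulo the rows of [V], in the coordinates of Cramer's rule. *)
Lemma mulmx_adj_remainder (n : nat) (V : 'M[int]_n) (w : 'rV[int]_n) :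
  let z := w *m \adj V in
  (w - (\row_i divz (z 0 i) (\det V)) *m V) *m \adj V =
  \row_i modz (z 0 i) (\det V).
Proof.
move=> z; rewrite mulmxBl -mulmxA mul_mx_adj mul_mx_scalar; apply/rowP => i.
rewrite [RHS]mxE [LHS]mxE; congr (_ + _).
by rewrite [LHS]mxE [X in - X]mxE [X in _ * X]mxE mulrC.
Qed.

(** A basis is a family of [n] vectors of the subgroup with nonzero determinant of
least absolute value: a vector outside their span would leave a nonzero
remainder, which could replace one of them. *)
Lemma lattice_basis (n : nat) (P : 'rV[int]_n -> Prop) (m : int) :
  m != 0 -> (forall x, P (m *: x)) ->
  (forall (z : int) x y, P x -> P y -> P (x - z *: y)) ->
  exists B : 'M[int]_n, [/\ \det B != 0, forall i, P (row i B)
    & forall c, P c -> exists c1, c = c1 *m B].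
Proof.
move=> m0 Pm Psub.
pose Q (k : nat) := `[< exists B : 'M[int]_n,
  [/\ forall i, P (row i B), (0 < k)%N & `|\det B|%N = k] >].
have exQ : exists k, Q k.
  exists (absz (\det (m%:M : 'M[int]_n))); apply/asboolP; exists m%:M; split => //.
    by move=> i; rewrite rowE mul_mx_scalar.
  by rewrite absz_gt0 det_scalar expf_neq0.
case: (ex_minnP exQ) => k /asboolP[B [PB k0 Bk]] kmin.
have B0 : \det B != 0 by rewrite -absz_gt0 Bk.
exists B; split => // c Pc.
pose z := c *m \adj B.
pose q : 'rV[int]_n := \row_i divz (z 0 i) (\det B).
have Psum (I : Type) (r : seq I) (a : I -> int) (g : I -> 'rV[int]_n) :
    (forall i, P (g i)) -> forall x, P x -> P (x - \sum_(i <- r) a i *: g i).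
  move=> Pg; elim: r => [|i r IH] x Px; first by rewrite big_nil subr0.
  by rewrite big_cons opprD addrA; apply: IH; apply: Psub.
pose c' := c - q *m B.
have Pc' : P c' by rewrite /c' mulmx_sum_row; apply: Psum.
have c'E : c' *m \adj B = \row_i modz (z 0 i) (\det B) := mulmx_adj_remainder B c.
(* A remainder with zero coordinates is zero. *)
suff c'0 : c' *m \adj B = 0.
  exists q; apply/eqP; rewrite -subr_eq0 -/c'; apply/eqP.
  have : c' *m \adj B *m B = 0 by rewrite c'0 mul0mx.
  rewrite -mulmxA mul_adj_mx mul_mx_scalar => /eqP.
  by rewrite scalemx_eq0 (negbTE B0) => /eqP.
apply/rowP => i; rewrite [RHS]mxE; apply/eqP; apply: contraT => ci0.
(* Replacing row [i] by the remainder gives the smaller determinant [z 0 i %% det B]. *)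
pose B' := \matrix_(a < n) (if a == i then c' else row a B).
have B'E : \det B' = (c' *m \adj B) 0 i.
  rewrite (expand_det_row _ i) mxE; apply: eq_bigr => j _.
  rewrite [B' i j]mxE eqxx [\adj B j i]mxE; congr (_ * (_ * \det _)).
  apply/matrixP => a b; rewrite !mxE.
  by rewrite eq_sym (negbTE (neq_lift _ _)) mxE.
have QB' : Q `|\det B'|%N.
  apply/asboolP; exists B'; split => //; last by rewrite absz_gt0 B'E.
  by move=> a; rewrite rowK; case: ifP.
have := kmin _ QB'; rewrite B'E c'E mxE -Bk leqNgt => /negP[].
have := modz_ge0 (z 0 i) B0; have := ltz_mod (z 0 i) B0.
by lia.
Qed.

Lemma char_poly_conj (R : idomainType) (n : nat) (B M M' : 'M[R]_n) :
  \det B != 0 -> B *m M = M' *m B -> char_poly M' = char_poly M.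
Proof.
move=> B0 BM; pose Bp := map_mx (@polyC R) B.
have Bp0 : \det Bp != 0 by rewrite det_map_mx polyC_eq0.
apply: (mulIf Bp0); rewrite /char_poly -!det_mulmx.
suff -> : char_poly_mx M' *m Bp = Bp *m char_poly_mx M by rewrite !det_mulmx mulrC.
by rewrite /char_poly_mx mulmxBl mulmxBr -!map_mxM BM scalar_mxC.
Qed.

Definition krylov (n : nat) (M : 'M[int]_n.+1) (c : 'rV[int]_n.+1) :
  'M[int]_n.+1 := \matrix_(i < n.+1) (c *m M ^+ i).

Lemma mulmx_exp_conj (n : nat) (B M M' : 'M[int]_n.+1) (i : nat) :
  B *m M = M' *m B -> B *m M ^+ i = M' ^+ i *m B.
Proof.
move=> BM; elim: i => [|i IH]; first by rewrite !expr0 mulmx1 mul1mx.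
by rewrite !exprS -!mulmxE mulmxA BM -mulmxA IH mulmxA.
Qed.

Lemma krylov_conj (n : nat) (B M M' : 'M[int]_n.+1) (c : 'rV[int]_n.+1) :
  B *m M = M' *m B -> krylov M (c *m B) = krylov M' c *m B.
Proof.
move=> BM; apply/row_matrixP => i.
by rewrite row_mul !rowK -!mulmxA (mulmx_exp_conj _ BM).
Qed.

Lemma map_mxX (K : nzRingType) (n : nat) (M : 'M[int]_n.+1) (i : nat) :
  map_mx (intr : int -> K) (M ^+ i) = map_mx intr M ^+ i.
Proof.
elim: i => [|i IH]; first by rewrite !expr0 map_mx1.
by rewrite !exprS -!mulmxE map_mxM IH.
Qed.

Lemma eigen_exp (K : fieldType) (n : nat) (M : 'M[K]_n.+1) (w : 'cV[K]_n.+1)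
    (a : K) (i : nat) : M *m w = a *: w -> M ^+ i *m w = a ^+ i *: w.
Proof.
move=> Mw; elim: i => [|i IH]; first by rewrite !expr0 mul1mx scale1r.
by rewrite exprS -mulmxE -mulmxA IH -scalemxAr Mw scalerA exprSr.
Qed.

(** Against a family of eigenvectors the Krylov matrix is a Vandermonde matrix
times a diagonal one, so it is singular only if [c] kills an eigenvector. *)
Lemma krylov_singular_eigen (K : fieldType) (n : nat) (M : 'M[int]_n.+1)
    (c : 'rV[int]_n.+1) (w : 'I_n.+1 -> 'cV[K]_n.+1) (l : 'I_n.+1 -> K) :
  injective l -> (forall j, map_mx intr M *m w j = l j *: w j) ->
  (\det (krylov M c))%:~R = 0 :> K -> exists j, map_mx intr c *m w j = 0.
Proof.
move=> linj Mw det0.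
pose W := \matrix_(a < n.+1, j < n.+1) w j a 0.
pose lv : 'rV[K]_n.+1 := \row_j l j.
pose dg : 'rV[K]_n.+1 := \row_j (map_mx intr c *m w j) 0 0.
have WE : map_mx intr (krylov M c) *m W = Vandermonde n.+1 lv *m diag_mx dg.
  apply/matrixP => i j; rewrite mul_mx_diag [RHS]mxE [dg 0 j]mxE.
  have -> : (map_mx intr (krylov M c) *m W) i j =
      (map_mx intr (c *m M ^+ i) *m w j) 0 0.
    by rewrite mxE [RHS]mxE; apply: eq_bigr => a _; rewrite ![map_mx _ _ _ _]mxE
      [krylov _ _ _ _]mxE [W _ _]mxE.
  by rewrite map_mxM map_mxX -mulmxA (eigen_exp _ (Mw j)) -scalemxAr !mxE.
have V0 : \det (Vandermonde n.+1 lv) != 0.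
  rewrite det_Vandermonde; apply/prodf_neq0 => i _; apply/prodf_neq0 => j ij.
  rewrite !mxE subr_eq0; apply: contraTneq ij => /linj ->; by rewrite ltnn.
have : \det (Vandermonde n.+1 lv *m diag_mx dg) = 0.
  by rewrite -WE det_mulmx det_map_mx [X in X * _]det0 mul0r.
rewrite det_mulmx det_diag => /eqP; rewrite mulf_eq0 (negbTE V0) /=.
move=> /prodf_eq0[j _ /eqP dj]; exists j; apply/matrixP => a b.
by rewrite !ord1 [RHS]mxE -[RHS]dj [dg 0 j]mxE.
Qed.

Lemma char_poly_trmx (R : comNzRingType) (n : nat) (A : 'M[R]_n) :
  char_poly A^T = char_poly A.
Proof.
rewrite /char_poly -det_tr /char_poly_mx linearB /= tr_scalar_mx map_trmx.
by rewrite trmxK.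
Qed.

Lemma pfactor_dvdn_mul_cancel (p j a b : nat) :
  prime p -> (0 < b)%N -> (p ^ j %| a * b -> p ^ (j - logn p b) %| a)%N.
Proof.
move=> pp b0; have [->|a0] := posnP a; first by rewrite dvdn0.
by rewrite !pfactor_dvdn ?muln_gt0 ?a0 // lognM //; lia.
Qed.

Lemma row_lattice_matrix (n : nat) (P : 'rV[int]_n -> Prop) (B A : 'M[int]_n) :
  (forall c, P c -> exists c1, c = c1 *m B) -> (forall i, P (row i A)) ->
  exists M, A = M *m B.
Proof.
move=> PB PA.
have /choice[g gE] : forall i, exists c1, row i A = c1 *m B by move=> i; apply: PB.
exists (\matrix_i g i); apply/row_matrixP => i.
by rewrite row_mul rowK -gE.
Qed.

(** A vector whose Krylov determinant is divisible by [p] kills one of the [n.+1]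
eigenvectors over [K], hence lies in one of [n.+1] stable sublattices of index a
power of [p].  In a basis of the sublattice the matrix keeps its characteristic
polynomial, and the determinant loses the index as a factor, so that one can
recurse.  The class of a vector records the sublattices met on the way; the
classes play the part of the ideals of norm [p ^ j]. *)
Lemma krylov_det_classes (p n : nat) (K : fieldType) (l : 'I_n.+1 -> K) :
  prime p -> p \in [pchar K] -> injective l ->
  forall (j : nat) (M : 'M[int]_n.+1),
  (forall i, root (map_poly intr (char_poly M)) (l i)) ->
  exists cl : 'rV[int]_n.+1 -> nat, (forall c, (cl c < n.+1 ^ j)%N) /\
    forall c c', ((p ^ j)%N %| \det (krylov M c))%Z ->
      ((p ^ j)%N %| \det (krylov M c'))%Z -> cl c = cl c' ->
      ((p ^ j)%N %| \det (krylov M (c - c')))%Z.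
Proof.
move=> pp pK linj; elim/ltn_ind => -[|j] IH M Mroot.
  exists (fun=> 0%N); split => // c c' _ _ _; by rewrite expn0 dvd1z.
have p0 (z : int) : (z%:~R == 0 :> K) = (p %| z)%Z by rewrite (dvdz_pcharf pK).
have exw i : exists w : 'cV[K]_n.+1, map_mx intr M *m w = l i *: w /\ w != 0.
  have : eigenvalue (map_mx intr M)^T (l i).
    by rewrite eigenvalue_root_char char_poly_trmx -map_char_poly.
  move=> /eigenvalueP[v vM v0]; exists v^T; split.
    by apply: trmx_inj; rewrite trmx_mul trmxK vM linearZ /= trmxK.
  by apply: contra v0 => /eqP v0; rewrite -[v]trmxK v0 trmx0.
have {exw} [w wP] := choice exw.
pose P i (c : 'rV[int]_n.+1) := map_mx intr c *m w i = 0.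
have exB i : exists BM : 'M[int]_n.+1 * 'M[int]_n.+1,
    [/\ \det BM.1 != 0, (p %| \det BM.1)%Z, BM.1 *m M = BM.2 *m BM.1
      & forall c, P i c -> exists c1, c = c1 *m BM.1].
  have [|||B [B0 PB Bc]] := @lattice_basis n.+1 (P i) p%:Z.
  - by rewrite eqz_nat -lt0n prime_gt0.
  - move=> x; rewrite /P map_mxZ -scalemxAl.
    have pz : (p%:Z)%:~R = 0 :> K by apply/eqP; rewrite p0.
    by rewrite [X in X *: _]pz scale0r.
  - move=> z x y; rewrite /P => Px Py.
    by rewrite map_mxB map_mxZ mulmxBl Px -scalemxAl Py scaler0 subr0.
  have [M' BM] : exists M', B *m M = M' *m B.
    apply: (row_lattice_matrix Bc) => a; have := PB a.
    rewrite /P row_mul => aw; rewrite map_mxM -mulmxA (wP i).1 -scalemxAr aw.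
    by rewrite scaler0.
  (* If [p] did not divide [det B], the rows of [B] would span everything. *)
  exists (B, M'); split => //=; rewrite -p0; apply/negPn/negP => detB.
  have : map_mx intr B *m w i = 0.
    by apply/row_matrixP => a; rewrite row_mul -map_row PB row0.
  have Bu : map_mx (intr : int -> K) B \in unitmx by rewrite unitmxE det_map_mx unitfE.
  move=> /(congr1 (mulmx (invmx (map_mx intr B)))); rewrite mulKmx // mulmx0 => wi0.
  by have := (wP i).2; rewrite wi0 eqxx.
have {exB} [BM BMP] := choice exB.
pose e i := logn p `|\det (BM i).1|%N.
have e0 i : (0 < e i)%N.
  case: (BMP i) => B0 pB _ _.
  by rewrite logn_gt0 mem_primes pp absz_gt0 B0.
have exl i : exists cl : 'rV[int]_n.+1 -> nat,
    (forall c, (cl c < n.+1 ^ (j.+1 - e i))%N) /\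
    forall c c', ((p ^ (j.+1 - e i))%N %| \det (krylov (BM i).2 c))%Z ->
      ((p ^ (j.+1 - e i))%N %| \det (krylov (BM i).2 c'))%Z -> cl c = cl c' ->
      ((p ^ (j.+1 - e i))%N %| \det (krylov (BM i).2 (c - c')))%Z.
  apply: IH; first by have := e0 i; lia.
  case: (BMP i) => B0 _ BMe _.
  by rewrite (char_poly_conj B0 BMe).
have {exl} [cl clP] := choice exl.
have exc (ic : 'I_n.+1 * 'rV[int]_n.+1) : exists c1, P ic.1 ic.2 -> ic.2 = c1 *m (BM ic.1).1.
  case: ic => i c /=; case: (pselect (P i c)) => [Pc|nPc]; last by exists 0.
  by case: (BMP i) => _ _ _ /(_ c Pc)[c1 c1E]; exists c1.
have {exc} [c1 c1P] := choice exc.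
have exg c : exists i, (\det (krylov M c))%:~R = 0 :> K -> P i c.
  case: (pselect ((\det (krylov M c))%:~R = 0 :> K)) => [d0|d0]; last by exists ord0.
  have [i Pi] := krylov_singular_eigen linj (fun i => (wP i).1) d0.
  by exists i.
have {exg} [g gP] := choice exg.
(* The class is written in base [n.+1]; its last digit names the eigenvector. *)
exists (fun c => (g c + n.+1 * cl (g c) (c1 (g c, c)))%N); split.
  move=> c; have := ltn_ord (g c); have := (clP (g c)).1 (c1 (g c, c)).
  move=> h1 h2; rewrite expnS.
  have : (n.+1 ^ (j.+1 - e (g c)) <= n.+1 ^ j)%N.
    by rewrite leq_pexp2l //; have := e0 (g c); lia.
  by nia.
move=> c c' pc pc' eqcl.
have pdvd a : ((p ^ j.+1)%N %| a)%Z -> a%:~R = 0 :> K.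
  move=> pa; apply/eqP; rewrite p0; apply: dvdz_trans pa.
  by rewrite dvdzE /= expnS dvdn_mulr.
have eqg : g c = g c'.
  apply: val_inj => /=; move: (congr1 (modn^~ n.+1) eqcl).
  by rewrite ![(_ + n.+1 * _)%N]addnC ![(n.+1 * _)%N]mulnC !modnMDl !modn_small.
have eqcl1 : cl (g c) (c1 (g c, c)) = cl (g c) (c1 (g c, c')).
  move: eqcl; rewrite -eqg => /addnI/eqP; rewrite eqn_pmul2l //.
  by move=> /eqP.
have Pc := c1P (g c, c) (gP _ (pdvd _ pc)).
have Pc' : P (g c) c' by rewrite eqg; apply: gP; apply: pdvd.
have {Pc'} Pc' := c1P (g c, c') Pc'; rewrite /= in Pc Pc'.
set i := g c in eqcl1 Pc Pc'.
case: (BMP i) => B0 _ BMe _.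
have low x : ((p ^ j.+1)%N %| \det (krylov M (x *m (BM i).1)))%Z ->
    ((p ^ (j.+1 - e i))%N %| \det (krylov (BM i).2 x))%Z.
  rewrite (krylov_conj _ BMe) det_mulmx !dvdzE abszM /=.
  by apply: pfactor_dvdn_mul_cancel; rewrite // absz_gt0.
rewrite Pc Pc' -mulmxBl (krylov_conj _ BMe) det_mulmx.
have := (clP i).2 (c1 (i, c)) (c1 (i, c')).
rewrite Pc in pc; rewrite Pc' in pc'.
move=> /(_ (low _ pc) (low _ pc') eqcl1) pd.
rewrite !dvdzE /= abszM in pd *.
apply: (@dvdn_trans (p ^ (j.+1 - e i) * p ^ e i)%N).
  by rewrite -expnD dvdn_exp2l //; lia.
by apply: dvdn_mul => //; apply: pfactor_dvdnn.
Qed.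

(** * The norm form of a monic polynomial *)

Definition companion (n : nat) (f : {poly int}) : 'M[int]_n.+1 :=
  \matrix_(i, j) (if i == n :> nat then - f`_j else (i.+1 == j :> nat)%:R).

Lemma char_poly_companion (n : nat) (f : {poly int}) :
  f \is monic -> size f = n.+2 -> char_poly (companion n f) = f.
Proof.
move=> fm sf; have e : (size f).-1 = n.+1 by rewrite sf.
have -> : companion n f = castmx (e, e) (companionmx f).
  apply/matrixP => i j; rewrite castmxE !mxE /=.
  by rewrite sf /=.
have castE m (e' : (size f).-1 = m) (A : 'M[int]_((size f).-1)) :
    char_poly (castmx (e', e') A) = char_poly A by case: m / e'.
by rewrite castE companionmxK.
Qed.

Lemma delta_companion_exp (n : nat) (f : {poly int}) (i : 'I_n.+1) :
  delta_mx 0 0 *m companion n f ^+ i = delta_mx 0 i :> 'rV_n.+1.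
Proof.
case: i => i; elim: i => [|i IH] lti /=.
  by rewrite expr0 mulmx1; congr delta_mx; apply: val_inj.
rewrite exprSr -mulmxE mulmxA (IH (ltnW lti)) -rowE; apply/rowP => j.
rewrite !mxE /= ltn_eqF //=.
by rewrite eq_sym.
Qed.

Definition powers_col (R : nzRingType) (n : nat) (r : R) : 'cV[R]_n :=
  \col_(i < n) r ^+ i.

Lemma companion_powers (n : nat) (f : {poly int}) (r : int) :
  f \is monic -> size f = n.+2 ->
  companion n f *m powers_col n.+1 r =
    r *: powers_col n.+1 r - f.[r] *: delta_mx ord_max 0.
Proof.
move=> fm sf; apply/colP => i; rewrite !mxE.
have [im|im] := eqVneq (i : nat) n.
  have -> : i == ord_max by apply/eqP/val_inj.
  rewrite mulr1 horner_coef sf [X in _ = _ - X]big_ord_recr /=.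
  have := monicP fm; rewrite lead_coefE sf /= => ->.
  rewrite mul1r im -exprS opprD addrCA subrr addr0 -sumrN.
  by apply: eq_bigr => j _; rewrite !mxE im eqxx mulNr.
have lti : (i.+1 < n.+1)%N by have := ltn_ord i; lia.
have -> : i == ord_max = false by apply/eqP => /(congr1 val) /=; lia.
rewrite mulr0 subr0 (bigD1 (Ordinal lti)) //= !mxE (negbTE im) /= eqxx mul1r.
rewrite big1 ?addr0 ?exprS // => j ji; rewrite !mxE (negbTE im).
case: eqP => [ij|]; last by rewrite mul0r.
by case/eqP: ji; apply: val_inj.
Qed.

Lemma krylov_companion (n : nat) (f : {poly int}) (a : 'rV[int]_n.+1) :
  krylov (companion n f) a = horner_mx (companion n f) (rVpoly a).
Proof.
set M := companion n f.
have e0 : delta_mx 0 0 *m horner_mx M (rVpoly a) = a :> 'rV_n.+1.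
  rewrite horner_rVpoly [a *m _]mulmx_sum_row linear_sum /= mulmx_sumr.
  rewrite [RHS]row_sum_delta; apply: eq_bigr => i _.
  by rewrite linearZ /= rowK mxvecK -scalemxAr delta_companion_exp.
apply/row_matrixP => i; rewrite rowK rowE -(delta_companion_exp f i) -mulmxA.
have -> : M ^+ i *m horner_mx M (rVpoly a) = horner_mx M (rVpoly a) *m M ^+ i.
  rewrite mulmxE; have := comm_horner_mx2 M 'X^i (rVpoly a).
  by rewrite rmorphXn /= horner_mx_X => ->.
by rewrite mulmxA e0.
Qed.

Lemma horner_mx_eigen (K : fieldType) (n : nat) (M : 'M[K]_n.+1)
    (w : 'cV[K]_n.+1) (r : K) (g : {poly K}) :
  M *m w = r *: w -> horner_mx M g *m w = g.[r] *: w.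
Proof.
move=> Mw; elim/poly_ind: g => [|g c IH]; first by rewrite rmorph0 mul0mx horner0 scale0r.
rewrite rmorphD rmorphM /= horner_mx_X horner_mx_C -mulmxE mulmxDl -mulmxA Mw.
rewrite -scalemxAr IH scalerA mul_scalar_mx -scalerDl.
by congr (_ *: _); rewrite !hornerE mulrC.
Qed.

Lemma rVpoly_horner (n : nat) (a : 'rV[int]_n) (r : int) :
  (rVpoly a).[r] = (a *m powers_col n r) 0 0.
Proof.
rewrite mxE (horner_coef_wide _ (size_poly _ _)); apply: eq_bigr => i _.
by rewrite coef_rVpoly_ord mxE.
Qed.

Lemma rat_poly_clear (g : {poly rat}) :
  exists (h : {poly int}) (m : int), m != 0 /\ map_poly intr h = m%:~R *: g.
Proof.
have [h [m m0 ->]] := rat_poly_scale g; exists h, m; split => //.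
by rewrite scalerA mulfV ?intr_eq0 // scale1r.
Qed.

Lemma int_Bezout (f g : {poly int}) :
  coprimep (map_poly intr f : {poly rat}) (map_poly intr g) ->
  exists (u v : {poly int}) (m : int), m != 0 /\ u * f + v * g = m%:P.
Proof.
move=> /Bezout_eq1_coprimepP[[u v] /= uv1].
have [u' [a [a0 u'E]]] := rat_poly_clear u.
have [v' [b [b0 v'E]]] := rat_poly_clear v.
exists (b%:P * u'), (a%:P * v'), (a * b); split; first by rewrite mulf_neq0.
have inj : injective (map_poly (intr : int -> rat)) by apply: map_inj_poly => //; apply: intr_inj.
apply: inj; rewrite rmorphD !rmorphM /= u'E v'E !map_polyC /=.
rewrite -!mul_polyC -[RHS]mulr1 -uv1.
set A := (a%:~R)%:P; set B := (b%:~R)%:P.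
ring.
Qed.

(** For [f] monic of degree [n.+1] this is the norm of the class of [rVpoly a] in
the ring of polynomials modulo [f]: the rows of the matrix are the coordinates of
its products with the powers of ['X]. *)
Definition nform (n : nat) (f : {poly int}) (a : 'rV[int]_n.+1) : int :=
  \det (krylov (companion n f) a).

Lemma nformZ (n : nat) (f : {poly int}) (q : int) (a : 'rV[int]_n.+1) :
  nform f (q *: a) = q ^+ n.+1 * nform f a.
Proof.
rewrite /nform -detZ; congr (\det _); apply/row_matrixP => i.
by rewrite linearZ /= !rowK scalemxAl.
Qed.

(** A nonzero [rVpoly a] has smaller degree than [f], hence is invertible modulo
[f] over the rationals. *)
Lemma nform_neq0 (n : nat) (f : {poly int}) (a : 'rV[int]_n.+1) :
  f \is monic -> size f = n.+2 ->
  irreducible_poly (map_poly intr f : {poly rat}) -> a != 0 -> nform f a != 0.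
Proof.
move=> fm sf firr a0.
have cop : coprimep (map_poly intr f : {poly rat}) (map_poly intr (rVpoly a)).
  rewrite irreducible_poly_coprime //; apply/negP => /dvdp_leq.
  rewrite !size_map_inj_poly ?sf //; try exact: intr_inj.
  have -> : map_poly (intr : int -> rat) (rVpoly a) != 0.
    have r0 : rVpoly a != 0 by apply: contra a0 => /eqP ra; rewrite -[a]rVpolyK ra linear0.
    by rewrite map_poly_eq0_id0 // intr_eq0 lead_coef_eq0.
  move=> /(_ isT) sa; have := leq_trans sa (size_poly _ _ : size (rVpoly a) <= n.+1)%N.
  by rewrite ltnn.
have [u [v [m [m0 uv]]]] := int_Bezout cop.
pose M := companion n f.
have := congr1 (horner_mx M) uv.
have CH : horner_mx M f = 0.
  by have := Cayley_Hamilton M; rewrite char_poly_companion.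
rewrite rmorphD !rmorphM /= CH mulr0 add0r.
rewrite -krylov_companion horner_mx_C => /(congr1 determinant).
rewrite -mulmxE det_mulmx det_scalar => E.
apply: contra_neq (expf_neq0 n.+1 m0) => N0.
by rewrite -E [X in _ * X]N0 mulr0.
Qed.

Lemma nform_bound (n : nat) (f : {poly int}) : exists C : nat, (0 < C)%N /\
  forall (s : nat) (a : 'rV[int]_n.+1), (forall i, (`|a 0%R i| <= s)%N) ->
    (forall i j, (`|krylov (companion n f) a i j| <= C * s)%N) /\
    (`|nform f a| <= C * s ^ n.+1)%N.
Proof.
pose M := companion n f.
pose C0 := (\sum_(i < n.+1) \sum_l \sum_j `|(M ^+ i) l j|)%N.
exists ((n.+1)`! * (C0.+1 ^ n.+1))%N; split; first by rewrite muln_gt0 fact_gt0 expn_gt0.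
move=> s a as_.
have kb (i j : 'I_n.+1) : (`|krylov M a i j| <= C0.+1 * s)%N.
  rewrite !mxE; apply: leq_trans (leq_absz_sum _) _.
  apply: (@leq_trans (\sum_l `|(M ^+ i) l j| * s)%N).
    by apply: leq_sum => l _; rewrite abszM mulnC leq_mul.
  rewrite -big_distrl leq_mul2r; apply/orP; right; apply: leqW.
  apply: (@leq_trans (\sum_l \sum_j `|(M ^+ i) l j|)%N).
    by apply: leq_sum => l _; rewrite (bigD1 j) //= leq_addr.
  by rewrite /C0 [leqRHS](bigD1 i) //= leq_addr.
split.
  move=> i j; apply: leq_trans (kb i j) _; rewrite leq_mul2r; apply/orP; right.
  by rewrite expnS mulnCA leq_pmulr // muln_gt0 fact_gt0 expn_gt0.
rewrite /nform -/M; apply: leq_trans (leq_absz_sum _) _.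
apply: (@leq_trans (\sum_(g : 'S_n.+1) (C0.+1 * s) ^ n.+1)%N).
  apply: leq_sum => g _; rewrite abszM abszX /= exp1n mul1n.
  have -> : (`|(\prod_i krylov M a i (g i))%R| = \prod_i `|krylov M a i (g i)|)%N.
    by apply: (big_morph absz abszM).
  have -> : ((C0.+1 * s) ^ n.+1 = \prod_(i < n.+1) (C0.+1 * s))%N.
    by rewrite prod_nat_const card_ord.
  by apply: leq_prod => i _; apply: kb.
by rewrite sum_nat_const card_Sn expnMn mulnA.
Qed.

Lemma krylov_delta (n : nat) (f : {poly int}) :
  krylov (companion n f) (delta_mx 0 0) = 1%:M.
Proof. by apply/row_matrixP => i; rewrite rowK row1 delta_companion_exp. Qed.

(** Modulo [p] the matrix is the identity. *)
Lemma nform_coprime (n : nat) (f : {poly int}) (p : nat) (q : int) (b : 'rV[int]_n.+1) :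
  prime p -> (p %| q)%Z -> ~~ (p %| nform f (delta_mx 0 0 + q *: b)%R)%Z.
Proof.
move=> pp pq; rewrite -Fp_intr_eq0 // /nform.
have -> : krylov (companion n f) (delta_mx 0 0 + q *: b) =
    1%:M + q *: krylov (companion n f) b.
  rewrite -(krylov_delta n f); apply/row_matrixP => i.
  by rewrite linearD linearZ /= !rowK mulmxDl scalemxAl.
rewrite -det_map_mx map_mxD map_mxZ map_mx1.
have q0 : q%:~R = 0 :> 'F_p by apply/eqP; rewrite Fp_intr_eq0.
by rewrite [X in X *: _]q0 scale0r addr0 det1 oner_eq0.
Qed.

Lemma nform_char_poly (n : nat) (f : {poly int}) (x : int) (b : 'rV[int]_n.+1) :
  nform f (x *: delta_mx 0 0 + b) =
  (char_poly (- krylov (companion n f) b)).[x].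
Proof.
have -> : (char_poly (- krylov (companion n f) b)).[x] =
    \det (map_mx (horner_eval x) (char_poly_mx (- krylov (companion n f) b))).
  by rewrite det_map_mx.
have cpE (A : 'M[int]_n.+1) i j : char_poly_mx A i j = 'X *+ (i == j) - (A i j)%:P.
  by rewrite /char_poly_mx !mxE.
congr (\det _); apply/matrixP => i j.
rewrite [RHS]mxE cpE /horner_eval hornerD hornerN hornerC hornerMn hornerX.
rewrite [LHS]mxE mulmxDl -scalemxAl delta_companion_exp [X in - X]mxE opprK.
rewrite [LHS]mxE [krylov _ _ i j]mxE; congr (_ + _).
by rewrite !mxE eqxx /= mulr_natr eq_sym.
Qed.

(** * Valuations of norms and common roots *)

Definition nroots (f : {poly int}) (p : nat) : nat :=
  #|[pred r : 'I_p | (p%:Z %| f.[r%:Z])%Z]|.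

(** The prime ideals of norm [p] that contain [rVpoly a]. *)
Definition ncommon (n : nat) (f : {poly int}) (a : 'rV[int]_n) (p : nat) : nat :=
  #|[pred r : 'I_p | (p%:Z %| f.[r%:Z])%Z && (p%:Z %| (rVpoly a).[r%:Z])%Z]|.

Lemma Fp_horner (p : nat) (g : {poly int}) (r : int) :
  (map_poly intr g).[r%:~R] = g.[r]%:~R :> 'F_p.
Proof. by rewrite horner_map. Qed.

Lemma Fp_krylov_eigen (n p : nat) (f : {poly int}) (a : 'rV[int]_n.+1)
    (w : 'cV['F_p]_n.+1) (r : int) :
  map_mx intr (companion n f) *m w = r%:~R *: w ->
  map_mx intr (krylov (companion n f) a) *m w = (rVpoly a).[r]%:~R *: w.
Proof.
move=> Mw; rewrite krylov_companion map_horner_mx (horner_mx_eigen _ Mw).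
by rewrite -Fp_horner.
Qed.

Lemma companion_eigen_root (n p : nat) (f : {poly int}) (r : int) :
  prime p -> f \is monic -> size f = n.+2 ->
  eigenvalue (map_mx (intr : int -> 'F_p) (companion n f))^T r%:~R = (p %| f.[r])%Z.
Proof.
move=> pp fm sf; rewrite eigenvalue_root_char char_poly_trmx -map_char_poly.
by rewrite char_poly_companion // rootE Fp_horner Fp_intr_eq0.
Qed.

(** A common root of [f] and [a] modulo [p] is an eigenvalue of the companion
matrix whose eigenspace is killed by the matrix of [a]; eigenspaces for distinct
eigenvalues are independent. *)
Lemma dvd_nform_ncommon (n p : nat) (f : {poly int}) (a : 'rV[int]_n.+1) :
  prime p -> f \is monic -> size f = n.+2 ->
  ((p ^ ncommon f a p)%N %| nform f a)%Z.
Proof.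
move=> pp fm sf; set M := companion n f.
apply: dvdz_trans (dvdz_det_corank (krylov M a) pp).
rewrite dvdzE /=; apply: dvdn_exp2l.
set Ab := map_mx _ _; pose g := (map_mx (intr : int -> 'F_p) M)^T.
rewrite -mxrank_tr -mxrank_ker.
pose P := [pred r : 'I_p | (p%:Z %| f.[r%:Z])%Z && (p%:Z %| (rVpoly a).[r%:Z])%Z].
pose ev (r : 'I_p) : 'F_p := (r%:Z)%:~R.
have evinj : {in P &, injective ev} by move=> r r' _ _; apply: Fp_ord_inj.
have /mxdirectP /= rS := mxdirect_sum_eigenspace g evinj.
have SK : (\sum_(r | P r) eigenspace g (ev r) <= kermx Ab^T)%MS.
  apply/sumsmx_subP => r /andP[_ ar]; apply/sub_kermxP.
  set U := eigenspace _ _.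
  have Ug : U *m g = ev r *: U by apply/eigenspaceP.
  apply/row_matrixP => j; rewrite row0 row_mul.
  have Mu : map_mx intr M *m (row j U)^T = (r%:Z)%:~R *: (row j U)^T.
    by rewrite -[map_mx _ _]trmxK -trmx_mul -/g -row_mul Ug linearZ linearZ.
  apply: trmx_inj; rewrite trmx_mul trmxK trmx0 (Fp_krylov_eigen a Mu).
  have -> : (rVpoly a).[r%:Z]%:~R = 0 :> 'F_p by apply/eqP; rewrite Fp_intr_eq0.
  by rewrite scale0r.
apply: leq_trans (mxrankS SK); rewrite rS /ncommon -sum1_card.
apply: leq_sum => r /andP[fr _]; rewrite lt0n mxrank_eq0.
by have := companion_eigen_root (r%:Z) pp fm sf; rewrite fr.
Qed.

(** When [p] divides the determinant exactly once, the kernel modulo [p] is a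
line; it is stable, and the eigenvalue on it is a common root. *)
Lemma ncommon_gt0 (n p : nat) (f : {poly int}) (a : 'rV[int]_n.+1) :
  prime p -> f \is monic -> size f = n.+2 ->
  logn p `|nform f a| = 1%N -> (0 < ncommon f a p)%N.
Proof.
move=> pp fm sf lg; set M := companion n f.
have N0 : (0 < `|nform f a|)%N by rewrite lt0n; apply: contra_eq_neq lg => ->; rewrite logn0.
have pN : (p %| nform f a)%Z.
  by rewrite dvdzE /= -[p in (p %| _)%N]expn1 pfactor_dvdn // lg.
set Ab := map_mx (intr : int -> 'F_p) (krylov M a).
pose g := (map_mx (intr : int -> 'F_p) M)^T.
have rk : (\rank (kermx Ab^T) <= 1)%N.
  have := dvdz_det_corank (krylov M a) pp.
  by rewrite dvdzE /= pfactor_dvdn // -/(nform f a) lg mxrank_ker mxrank_tr.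
have rk0 : kermx Ab^T != 0.
  rewrite kermx_eq0 row_free_unit unitmx_tr unitmxE det_map_mx unitfE negbK.
  by rewrite Fp_intr_eq0.
have [u uK u0] := rowV0Pn rk0.
have Ku : (kermx Ab^T <= u)%MS.
  have := mxrank_leqif_eq uK => /leqifP; case: ifP => [/andP[_ ->] //|_].
  by rewrite rank_rV u0; move: rk; case: (\rank _) => [|[]].
have uAb : u *m Ab^T = 0 by apply/sub_kermxP.
have comm : g *m Ab^T = Ab^T *m g.
  rewrite -!trmx_mul; congr trmx; rewrite -!map_mxM; congr map_mx.
  rewrite krylov_companion; have := comm_horner_mx2 M 'X (rVpoly a).
  by rewrite horner_mx_X => E; rewrite !mulmxE E.
have /sub_rVP[l ul] : (u *m g <= u)%MS.
  by apply: submx_trans Ku; apply/sub_kermxP; rewrite -mulmxA comm mulmxA uAb mul0mx.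
have pE : (Zp_trunc (pdiv p)).+2 = p by apply: Fp_cast.
have ltl : (l < p)%N by rewrite -[X in (_ < X)%N]pE.
have lE : (l : nat)%:Z%:~R = l := Fp_lift l.
apply/card_gt0P; exists (Ordinal ltl); rewrite inE /=.
apply/andP; split.
  rewrite -(companion_eigen_root _ pp fm sf) lE.
  by apply/eigenvalueP; exists u.
have Mw : map_mx intr M *m u^T = (l : nat)%:Z%:~R *: u^T.
  by rewrite lE -linearZ /= -ul trmx_mul trmxK.
have := Fp_krylov_eigen a Mw; rewrite -/M -/Ab.
have -> : Ab *m u^T = 0 by rewrite -[Ab]trmxK -trmx_mul uAb trmx0.
move=> /esym/eqP; rewrite scalemx_eq0 -trmx0 (inj_eq trmx_inj) (negbTE u0) orbF.
by rewrite Fp_intr_eq0.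
Qed.

(** A valuation [v] is at most 1 when no higher power divides, and then
[ncommon_gt0] applies; otherwise it is at most [2 * (v - 1)]. *)
Lemma logn_nform_le (n p J : nat) (f : {poly int}) (a : 'rV[int]_n.+1) :
  prime p -> f \is monic -> size f = n.+2 -> (`|nform f a| < p ^ J)%N ->
  (logn p `|nform f a| <=
     ncommon f a p + 2 * \sum_(2 <= j < J) (p ^ j %| `|nform f a|))%N.
Proof.
move=> pp fm sf NJ; have [->|N0] := posnP `|nform f a|; first by rewrite logn0.
have vJ : (logn p `|nform f a| < J)%N.
  rewrite -(ltn_exp2l _ _ (prime_gt1 pp)); apply: leq_ltn_trans NJ.
  by apply: dvdn_leq => //; apply: pfactor_dvdnn.
case v : (logn p `|nform f a|) vJ => [|[|v']] // vJ.
  by have := ncommon_gt0 pp fm sf v; lia.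
suff -> : (\sum_(2 <= j < J) (p ^ j %| `|nform f a|) = v'.+1)%N by lia.
rewrite (@big_cat_nat _ _ _ v'.+3) //=.
rewrite [X in (_ + X)%N]big_nat [X in (_ + X)%N]big1 ?addn0; last first.
  by move=> j /andP[vj _]; rewrite pfactor_dvdn // v leqNgt vj.
rewrite big_nat (eq_bigr (fun=> 1%N)); last first.
  by move=> j /andP[_ jv]; rewrite pfactor_dvdn // v -ltnS jv.
by rewrite -big_nat sum_nat_const_nat muln1; lia.
Qed.

(** * Counting vectors of a box by cells *)

Lemma divn_eq_dist (x x' s : nat) : (0 < s)%N -> (x %/ s = x' %/ s)%N ->
  (`|x%:Z - x'%:Z| < s)%N.
Proof.
move=> s0 E; have := divn_eq x s; have := divn_eq x' s.
have := ltn_pmod x s0; have := ltn_pmod x' s0; rewrite E.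
by move: (x' %/ s * s)%N (x %% s)%N (x' %% s)%N => a b c; lia.
Qed.

(** Each cell of side [s] holds at most one point of each class. *)
Lemma card_box_cells (n y s m : nat) (A : {pred {ffun 'I_n -> 'I_y}})
    (lab : {ffun 'I_n -> 'I_y} -> nat) : (0 < s)%N ->
  (forall b, (lab b < m)%N) ->
  (forall b b', b \in A -> b' \in A -> lab b = lab b' ->
     (forall i, (`|(b i)%:Z - (b' i)%:Z| < s)%N) -> b = b') ->
  (#|A| <= m * (y %/ s).+1 ^ n)%N.
Proof.
move=> s0 labm inj.
pose h (b : {ffun 'I_n -> 'I_y}) : 'I_m * {ffun 'I_n -> 'I_(y %/ s).+1} :=
  (Ordinal (labm b), [ffun i => inord (b i %/ s)]).
have hinj : {in A &, injective h}.
  move=> b b' bA b'A [lE /ffunP cE]; apply: inj => // i.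
  have /(congr1 val) := cE i; rewrite !ffunE /= !inordK; last 2 first.
  - by rewrite ltnS leq_div2r // ltnW.
  - by rewrite ltnS leq_div2r // ltnW.
  exact: divn_eq_dist.
rewrite -(card_in_image hinj); apply: leq_trans (max_card _) _.
by rewrite card_prod card_ffun !card_ord.
Qed.

(** Near a face the distance to that face replaces one coordinate, so that one of
the factors does not grow with [y]. *)
Lemma card_slab_cells (n y s T : nat) (A : {pred {ffun 'I_n.+1 -> 'I_y}}) :
  (0 < s)%N ->
  (forall b, b \in A -> exists i, (b i < T)%N \/ (y <= b i + T)%N) ->
  (forall b b', b \in A -> b' \in A ->
     (forall i, (`|(b i)%:Z - (b' i)%:Z| < s)%N) -> b = b') ->
  (#|A| <= (n.+1 * 2 * (T %/ s).+1) * (y %/ s).+1 ^ n)%N.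
Proof.
move=> s0 slab inj.
have exf b : exists iu : 'I_n.+1 * bool, b \in A ->
    if iu.2 then (y <= b iu.1 + T)%N else (b iu.1 < T)%N.
  case: (boolP (b \in A)) => [/slab[i [bi|bi]]|bA]; last by exists (ord0, true).
    by exists (i, false).
  by exists (i, true).
have {exf} [fc fcP] := choice exf.
pose off b := if (fc b).2 then (y.-1 - b (fc b).1)%N else nat_of_ord (b (fc b).1).
pose h (b : {ffun 'I_n.+1 -> 'I_y}) :
   ('I_n.+1 * bool) * 'I_(T %/ s).+1 * {ffun 'I_n -> 'I_(y %/ s).+1} :=
  (fc b, inord (off b %/ s), [ffun i => inord (b (lift (fc b).1 i) %/ s)]).
have hinj : {in A &, injective h}.
  move=> b b' bA b'A [fE oE /ffunP cE]; apply: inj => // i.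
  have offT b1 : b1 \in A -> (off b1 <= T)%N.
    by move=> /fcP; rewrite /off; have := ltn_ord (b1 (fc b1).1); case: (fc b1).2; lia.
  have [j ->|->] := unliftP (fc b).1 i.
    have /(congr1 val) := cE j; rewrite !ffunE /= !inordK; last 2 first.
    - by rewrite ltnS leq_div2r // ltnW.
    - by rewrite ltnS leq_div2r // ltnW.
    by rewrite -fE; apply: divn_eq_dist.
  have /(congr1 val) := oE; rewrite /= !inordK; last 2 first.
  - by rewrite ltnS leq_div2r // offT.
  - by rewrite ltnS leq_div2r // offT.
  move=> /(divn_eq_dist s0); rewrite /off -fE.
  have := ltn_ord (b (fc b).1); have := ltn_ord (b' (fc b).1).
  case: (fc b).2 => //.
  by move: (nat_of_ord (b _)) (nat_of_ord (b' _)) => u v; clear; lia.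
rewrite -(card_in_image hinj); apply: leq_trans (max_card _) _.
by rewrite !card_prod card_ffun card_bool !card_ord.
Qed.

Definition boxv (n y : nat) (b : {ffun 'I_n -> 'I_y}) : 'rV[int]_n :=
  \row_i (b i)%:Z.

(** Being congruent to the unit modulo [q], these vectors have norms coprime to
[q], which disposes of the finitely many bad primes. *)
Definition boxu (n y q : nat) (b : {ffun 'I_n.+1 -> 'I_y}) : 'rV[int]_n.+1 :=
  delta_mx 0 0 + q%:Z *: boxv b.

Lemma boxv_inj (n y : nat) : injective (@boxv n y).
Proof.
move=> b b' /rowP E; apply/ffunP => i; apply: val_inj.
by have := E i; rewrite !mxE => -[].
Qed.

(** A nonzero vector cannot have a norm both divisible by [m] and less than [m]. *)
Lemma nform_small_eq (n y s m : nat) (f : {poly int}) (C : nat)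
    (b b' : {ffun 'I_n.+1 -> 'I_y}) :
  f \is monic -> size f = n.+2 ->
  irreducible_poly (map_poly intr f : {poly rat}) ->
  (forall (s : nat) (a : 'rV[int]_n.+1), (forall i, (`|a 0%R i| <= s)%N) ->
    (`|nform f a| <= C * s ^ n.+1)%N) ->
  (C * s ^ n.+1 < m)%N ->
  (m %| nform f (boxv b - boxv b'))%Z ->
  (forall i, (`|(b i)%:Z - (b' i)%:Z| < s)%N) -> b = b'.
Proof.
move=> fm sf firr bnd Cm mN bs; apply: boxv_inj; apply/eqP.
rewrite -subr_eq0; apply: contraTT mN => nz.
have N0 := nform_neq0 fm sf firr nz; apply/negP.
rewrite dvdzE /= => /dvdn_leq; rewrite lt0n absz_eq0 N0 => /(_ isT).
rewrite leqNgt => /negP[]; apply: leq_ltn_trans Cm; apply: bnd => i.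
by rewrite !mxE ltnW.
Qed.

Lemma card_nform_dvd (n y s p q j : nat) (f : {poly int}) (C : nat)
    (K : fieldType) (l : 'I_n.+1 -> K) :
  f \is monic -> size f = n.+2 ->
  irreducible_poly (map_poly intr f : {poly rat}) ->
  (forall (s : nat) (a : 'rV[int]_n.+1), (forall i, (`|a 0%R i| <= s)%N) ->
    (`|nform f a| <= C * s ^ n.+1)%N) ->
  prime p -> ~~ (p %| q)%N -> p \in [pchar K] -> injective l ->
  (forall i, root (map_poly intr f) (l i)) ->
  (0 < s)%N -> (C * s ^ n.+1 < p ^ j)%N ->
  (#|[pred b : {ffun 'I_n.+1 -> 'I_y} | (p ^ j %| `|nform f (boxu q b)|)%N]|
     <= n.+1 ^ j * (y %/ s).+1 ^ n.+1)%N.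
Proof.
move=> fm sf firr bnd pp pq pK linj froot s0 Cs.
have [|cl [clj clP]] := krylov_det_classes pp pK linj j (M := companion n f).
  by move=> i; rewrite char_poly_companion.
apply: (@card_box_cells _ _ s _ _ (fun b => cl (boxu q b))) => //.
move=> b b'; rewrite !inE => pb pb' /(clP _ _ pb pb') pd.
apply: (nform_small_eq fm sf firr bnd Cs).
move: pd; rewrite -/(nform f (boxu q b - boxu q b')).
have -> : boxu q b - boxu q b' = q%:Z *: (boxv b - boxv b').
  by rewrite /boxu scalerBr opprD addrACA subrr add0r.
rewrite nformZ Gauss_dvdzr // coprimezE abszX /=.
by rewrite coprimeXr // coprimeXl // prime_coprime.
Qed.

(** * Equidistribution of residues in a box *)

(** When [r] is a root of [f] modulo [p], the kernel of this linear form is the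
lattice of a prime ideal of norm [p]. *)
Definition evp (p n : nat) (r : int) (a : 'rV[int]_n) : 'F_p :=
  (rVpoly a).[r]%:~R.

Lemma evpE (p n : nat) (r : int) (a : 'rV[int]_n) :
  evp p r a = ((a *m powers_col n r) 0 0)%:~R.
Proof. by rewrite /evp rVpoly_horner. Qed.

Lemma evpB (p n : nat) (r : int) (a b : 'rV[int]_n) :
  evp p r (a - b) = evp p r a - evp p r b.
Proof. by rewrite !evpE mulmxBl mxE [X in _ + X]mxE rmorphB. Qed.

Lemma evpD (p n : nat) (r : int) (a b : 'rV[int]_n) :
  evp p r (a + b) = evp p r a + evp p r b.
Proof. by rewrite !evpE mulmxDl mxE rmorphD. Qed.

Lemma evpZ (p n : nat) (r z : int) (a : 'rV[int]_n) :
  evp p r (z *: a) = z%:~R * evp p r a.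
Proof. by rewrite !evpE -scalemxAl mxE rmorphM. Qed.

Lemma evp_delta (p n : nat) (r : int) :
  evp p r (delta_mx 0 0 : 'rV_n.+1) = 1.
Proof. by rewrite evpE -rowE !mxE expr0. Qed.

Lemma evp_companion (p n : nat) (r : int) (f : {poly int}) (a : 'rV[int]_n.+1) (i : nat) :
  prime p -> f \is monic -> size f = n.+2 -> (p %| f.[r])%Z ->
  evp p r (a *m companion n f ^+ i) = r%:~R ^+ i * evp p r a.
Proof.
move=> pp fm sf fr; elim: i => [|i IH]; first by rewrite !expr0 mulmx1 mul1r.
rewrite exprSr -mulmxE mulmxA exprS -mulrA -IH.
rewrite !evpE -mulmxA companion_powers // mulmxBr -!scalemxAr.
have E (x y : int) (A B : 'M[int]_1) : (x *: A - y *: B) 0 0 = x * A 0 0 - y * B 0 0.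
  by rewrite !mxE.
rewrite E.
rewrite rmorphB !rmorphM /=.
have -> : f.[r]%:~R = 0 :> 'F_p by apply/eqP; rewrite Fp_intr_eq0.
by rewrite mul0r subr0.
Qed.

Lemma evp0_nform (p n : nat) (r : int) (f : {poly int}) (a : 'rV[int]_n.+1) :
  prime p -> f \is monic -> size f = n.+2 -> (p %| f.[r])%Z ->
  evp p r a = 0 -> (p %| nform f a)%Z.
Proof.
move=> pp fm sf fr ev0; rewrite -Fp_intr_eq0 // /nform -det_map_mx.
set A := map_mx _ _; pose w : 'cV['F_p]_n.+1 := map_mx intr (powers_col n.+1 r).
have Aw : A *m w = 0.
  rewrite -map_mxM; apply/row_matrixP => i; rewrite row0 -map_row row_mul rowK.
  apply/rowP => j; rewrite [RHS]mxE mxE ord1.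
  by have := evp_companion a i pp fm sf fr; rewrite evpE ev0 mulr0.
apply: contraT => A0; have Au : A \in unitmx by rewrite unitmxE unitfE.
have : w 0 0 = 0 by rewrite -[w](mulKmx Au) Aw mulmx0 mxE.
by rewrite !mxE expr0 => /eqP; rewrite oner_eq0.
Qed.

(** By the pigeonhole principle, two points of a box with more than [p] elements
have the same residue. *)
Lemma short_vector (p n s : nat) (r : int) : prime p -> (p < s.+1 ^ n)%N ->
  exists v : 'rV[int]_n, [/\ v != 0, evp p r v = 0 & forall i, (`|v 0%R i| <= s)%N].
Proof.
move=> pp ps; pose h (b : {ffun 'I_n -> 'I_s.+1}) := evp p r (boxv b).
have : ~~ injectiveb h.
  apply/injectiveP => /leq_card; rewrite card_ffun !card_ord Fp_cast //.
  by rewrite leqNgt ps.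
move=> /injectivePn[b [b' bb' hE]]; exists (boxv b - boxv b'); split.
- by rewrite subr_eq0; apply: contra bb' => /eqP/boxv_inj ->.
- by rewrite evpB -/(h b) hE subrr.
- by move=> i; rewrite !mxE; have := ltn_ord (b i); have := ltn_ord (b' i);
    move: (nat_of_ord (b i)) (nat_of_ord (b' i)) => u v; clear; lia.
Qed.

(** A short vector [v] of the lattice generates a sublattice with the short basis
[v M ^ i]; reduction modulo that basis makes any vector short. *)
Lemma short_representative (p n s C : nat) (r : int) (f : {poly int}) :
  prime p -> f \is monic -> size f = n.+2 ->
  irreducible_poly (map_poly intr f : {poly rat}) ->
  (p %| f.[r])%Z -> (p < s.+1 ^ n.+1)%N ->
  (forall (s : nat) (a : 'rV[int]_n.+1), (forall i, (`|a 0%R i| <= s)%N) ->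
    (forall i j, (`|krylov (companion n f) a i j| <= C * s)%N)) ->
  forall t : 'F_p, exists w : 'rV[int]_n.+1, evp p r w = t /\
    forall i, (`|w 0%R i| <= n.+1 * (C * s))%N.
Proof.
move=> pp fm sf firr fr ps bnd t.
have [v [v0 vev vs]] := short_vector r pp ps.
pose V := krylov (companion n f) v; pose D := \det V.
have D0 : D != 0 := nform_neq0 fm sf firr v0.
pose w0 : 'rV[int]_n.+1 := (t : nat)%:Z *: delta_mx 0 0.
have w0t : evp p r w0 = t by rewrite evpZ evp_delta mulr1 Fp_lift.
pose z := w0 *m \adj V.
pose q : 'rV[int]_n.+1 := \row_i divz (z 0 i) D.
pose w := w0 - q *m V.
have evq : evp p r (q *m V) = 0.
  rewrite mulmx_sum_row; apply: (big_ind (fun x => evp p r x = 0)).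
  - by rewrite evpE mul0mx mxE.
  - by move=> x y xE yE; rewrite evpD xE yE addr0.
  - by move=> i _; rewrite evpZ rowK evp_companion // vev !mulr0.
exists w; split; first by rewrite evpB evq subr0.
move=> j.
have wD : D * w 0 j = \sum_i modz (z 0 i) D * V i j.
  have E : w *m \adj V = \row_i modz (z 0 i) D := mulmx_adj_remainder V w0.
  have : w *m \adj V *m V = \row_i modz (z 0 i) D *m V by rewrite E.
  rewrite -mulmxA mul_adj_mx mul_mx_scalar => /rowP/(_ j).
  rewrite mxE => ->; rewrite mxE; apply: eq_bigr => i _.
  by rewrite [X in X * _]mxE.
have absD : (0 < `|D|)%N by rewrite absz_gt0.
rewrite -(leq_pmul2l absD) -abszM wD.
apply: leq_trans (leq_absz_sum _) _.
rewrite mulnCA -[X in (X * _)%N]card_ord -sum_nat_const; apply: leq_sum => i _.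
rewrite abszM; apply: leq_mul; last exact: bnd.
by have := modz_ge0 (z 0 i) D0; have := ltz_mod (z 0 i) D0; lia.
Qed.

(** Translation by a short vector turns one residue into the other, and loses only
points near the faces of the box, of which the cells leave room for few. *)
Lemma count_residue_le (p n y s0 s C : nat) (r : int) (f : {poly int}) :
  prime p -> f \is monic -> size f = n.+2 ->
  irreducible_poly (map_poly intr f : {poly rat}) ->
  (p %| f.[r])%Z -> (p < s0.+1 ^ n.+1)%N -> (0 < s)%N -> (C * s ^ n.+1 < p)%N ->
  (forall (s : nat) (a : 'rV[int]_n.+1), (forall i, (`|a 0%R i| <= s)%N) ->
    (forall i j, (`|krylov (companion n f) a i j| <= C * s)%N) /\
    (`|nform f a| <= C * s ^ n.+1)%N) ->
  forall t t' : 'F_p,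
  (#|[pred b : {ffun 'I_n.+1 -> 'I_y} | evp p r (boxv b) == t]| <=
   #|[pred b : {ffun 'I_n.+1 -> 'I_y} | evp p r (boxv b) == t']| +
   n.+1 * 2 * ((n.+1 * (C * s0)) %/ s).+1 * (y %/ s).+1 ^ n)%N.
Proof.
move=> pp fm sf firr fr ps0 spos Cs bnd t t'.
have bnd1 s' a H := (bnd s' a H).1; have bnd2 s' a H := (bnd s' a H).2.
have [w [wt wT]] := short_representative pp fm sf firr fr ps0 bnd1 (t' - t).
set T := (n.+1 * (C * s0))%N in wT *.
pose A := [pred b : {ffun 'I_n.+1 -> 'I_y} | evp p r (boxv b) == t].
pose good := [pred b : {ffun 'I_n.+1 -> 'I_y} |
  [forall i, (0 <= (b i)%:Z + w 0 i) && ((b i)%:Z + w 0 i < y%:Z)]].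
rewrite -(cardID good); apply: leq_add.
  pose sh (b : {ffun 'I_n.+1 -> 'I_y}) := [ffun i => insubd (b i) (absz ((b i)%:Z + w 0 i))].
  have shE b : b \in good -> boxv (sh b) = boxv b + w.
    move=> /forallP gb; apply/rowP => i; rewrite !mxE ffunE val_insubd.
    have /andP[g1 g2] := gb i.
    have -> : (absz ((b i)%:Z + w 0 i)%R < y)%N.
      by move: g1 g2; move: (nat_of_ord (b i)) (w 0 i) => u v; clear; lia.
    by move: g1; move: (nat_of_ord (b i)) (w 0 i) => u v; clear; lia.
  have shinj : {in [predI [pred b | evp p r (boxv b) == t] & good] &, injective sh}.
    move=> b b' /andP[_ gb] /andP[_ gb'] E; apply: boxv_inj.
    by apply: (addIr w); rewrite -!shE // E.
  rewrite -(card_in_image shinj); apply: subset_leq_card; apply/fintype.subsetP => b'.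
  move=> /fintype.imageP[b /andP[bt gb] ->]; rewrite inE shE // evpD wt.
  by move: bt; rewrite inE => /eqP ->; rewrite addrC subrK.
apply: (card_slab_cells spos).
  move=> b; rewrite !inE => /andP[/forallPn[i bi] _]; exists i.
  have := wT i; move: bi; rewrite negb_and -leNgt -ltNge.
  by move: (nat_of_ord (b i)) (w 0 i) => u v; clear; lia.
move=> b b' /andP[_ bt] /andP[_ bt']; apply: (nform_small_eq fm sf firr bnd2 Cs).
apply: evp0_nform fr _ => //; rewrite evpB.
by move: bt bt'; rewrite !inE => /eqP -> /eqP ->; rewrite subrr.
Qed.

Lemma card_box (n y : nat) : #|{: {ffun 'I_n -> 'I_y}}| = (y ^ n)%N.
Proof. by rewrite card_ffun !card_ord. Qed.

Lemma sum_count_fibers (T U : finType) (h : T -> U) :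
  (\sum_(u : U) #|[pred b | h b == u]| = #|T|)%N.
Proof.
rewrite -sum1_card (partition_big h predT) //=.
by apply: eq_bigr => u _; rewrite -sum1_card.
Qed.

(** Fibres whose sizes differ by at most [e] are within [e] of the mean size. *)
Lemma near_average (T U : finType) (h : T -> U) (e : nat) :
  (forall u u', #|[pred b | h b == u]| <= #|[pred b | h b == u']| + e)%N ->
  forall u, (#|U| * #|[pred b | h b == u]| <= #|T| + #|U| * e)%N /\
            (#|T| <= #|U| * #|[pred b | h b == u]| + #|U| * e)%N.
Proof.
move=> H u; rewrite -(sum_count_fibers h) -!sum_nat_const -!big_split /=.
by split; apply: leq_sum => u' _; apply: H.
Qed.

Lemma exists_iroot (d m : nat) : (0 < d)%N ->
  exists s, (s ^ d <= m)%N /\ (m < s.+1 ^ d)%N.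
Proof.
move=> d0; have ex : exists s, (m < s.+1 ^ d)%N.
  by exists m; rewrite -{1}[m.+1]expn1 leq_pexp2l.
case: (ex_minnP ex) => -[|s] ms smin; first by exists 0%N; rewrite exp0n.
exists s.+1; split => //; rewrite leqNgt; apply/negP => /smin.
by rewrite ltnn.
Qed.

(** In cells of side [s] differences have norm less than [m], whereas [s0] bounds
the shortest vector of a lattice of index [m]; both are comparable with the root
of order [d] of [m]. *)
Lemma exists_scale (d C m : nat) : (0 < d)%N -> (C.+1 ^ d <= m)%N ->
  exists s0 s, [/\ (m < s0.+1 ^ d)%N, (0 < s)%N, (s0 <= 2 * C.+1 * s)%N,
    (C * s ^ d < m)%N & (m < (2 * C.+1 * s) ^ d)%N].
Proof.
move=> d0 Cm; have [s0 [s0m ms0]] := exists_iroot m d0.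
have cs0 : (C.+1 <= s0)%N.
  by have := leq_ltn_trans Cm ms0; rewrite ltn_exp2r.
exists s0, (s0 %/ C.+1)%N; have := divn_eq s0 C.+1; have := ltn_pmod s0 (ltn0Sn C).
set s := (s0 %/ C.+1)%N; set e := (s0 %% C.+1)%N => eC s0E.
have spos : (0 < s)%N by rewrite divn_gt0.
have s0s : (s0.+1 <= 2 * C.+1 * s)%N by nia.
split => //; first by apply: ltnW.
  have m0 : (0 < m)%N by apply: leq_trans Cm; rewrite expn_gt0.
  have : (s ^ d * C.+1 ^ d <= m)%N.
    by rewrite -expnMn; apply: leq_trans s0m; rewrite leq_exp2r // leq_divM.
  have : (C.+1 <= C.+1 ^ d)%N by rewrite -{1}[C.+1]expn1 leq_pexp2l.
  have : (0 < s ^ d)%N by rewrite expn_gt0 spos.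
  move: (s ^ d)%N (C.+1 ^ d)%N => u v; nia.
by apply: leq_trans ms0 _; rewrite leq_exp2r.
Qed.

(** * Uniform estimates for the norms over a box *)

(** A Bezout identity for [f] and its derivative survives modulo every prime that
does not divide its constant. *)
Lemma monic_irreducible_separable (n : nat) (f : {poly int}) :
  f \is monic -> size f = n.+2 ->
  irreducible_poly (map_poly intr f : {poly rat}) ->
  exists2 m : nat, (0 < m)%N & forall p, prime p -> (m < p)%N ->
  exists (K : fieldType) (l : 'I_n.+1 -> K), [/\ p \in [pchar K], injective l &
    forall i, root (map_poly intr f) (l i)].
Proof.
move=> fm sf firr.
have sfQ : size (map_poly (intr : int -> rat) f) = n.+2.
  by rewrite size_map_inj_poly // ; exact: intr_inj.
have cop : coprimep (map_poly intr f : {poly rat}) (map_poly intr f^`()).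
  rewrite -deriv_map irreducible_poly_coprime //; apply/negP => /dvdp_leq.
  have d0 : (map_poly (intr : int -> rat) f)^`() != 0.
    apply/eqP => /polyP/(_ n); rewrite coef_deriv coef0 coef_map /=.
    have := monicP fm; rewrite lead_coefE sf /= => -> /eqP.
    by rewrite mulr1z pnatr_eq0.
  move=> /(_ d0); rewrite sfQ leqNgt => /negP[].
  by rewrite -sfQ lt_size_deriv // -size_poly_eq0 sfQ.
have [u [v [m [m0 uv]]]] := int_Bezout cop.
exists `|m|%N; first by rewrite absz_gt0.
move=> p pp mp; have [K [toK _]] := countable_algebraic_closure 'F_p.
have pK : p \in [pchar K] by apply: rmorph_pchar toK _ (pchar_Fp pp).
pose fK : {poly K} := map_poly intr f.
have [rs] := closed_field_poly_normal fK.
have fKm : fK \is monic by apply: monic_map.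
rewrite (monicP fKm) scale1r => fKE.
have srs : size rs = n.+1.
  have : size fK = n.+2 by rewrite size_map_poly_id0 // (monicP fm) oner_eq0.
  by rewrite fKE size_prod_XsubC => -[].
have urs : uniq rs.
  rewrite -separable_prod_XsubC -fKE separable_poly.unlock deriv_map.
  apply/Bezout_eq1_coprimepP.
  have mK : m%:~R != 0 :> K.
    rewrite -(dvdz_pcharf pK) dvdzE /=; apply/negP => /dvdn_leq.
    by rewrite absz_gt0 m0 => /(_ isT); rewrite leqNgt mp.
  exists ((m%:~R^-1)%:P * map_poly intr u, (m%:~R^-1)%:P * map_poly intr v) => /=.
  have := congr1 (map_poly (intr : int -> K)) uv.
  rewrite rmorphD !rmorphM /= map_polyC /= => E.
  rewrite -!mulrA -mulrDr E -polyCM.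
  by rewrite mulVf.
exists K, (fun i => rs`_i); split => //.
  move=> i i' /eqP; rewrite nth_uniq ?srs // => /eqP; exact: val_inj.
by move=> i; rewrite -/fK fKE root_prod_XsubC mem_nth // srs.
Qed.

Lemma nroots_le (n p : nat) (f : {poly int}) :
  prime p -> f \is monic -> size f = n.+2 -> (nroots f p <= n.+1)%N.
Proof.
move=> pp fm sf; rewrite /nroots -ltnS -sf.
pose fp : {poly 'F_p} := map_poly intr f.
have sfp : size fp = size f by rewrite size_map_poly_id0 // (monicP fm) oner_eq0.
pose ev (r : 'I_p) : 'F_p := (r%:Z)%:~R.
have evinj : injective ev by apply: Fp_ord_inj.
rewrite -sfp cardE -(size_map ev); apply: max_poly_roots.
- by rewrite -size_poly_eq0 sfp sf.
- apply/allP => x /mapP[r]; rewrite mem_enum => fr ->.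
  by rewrite rootE Fp_horner Fp_intr_eq0.
- by rewrite map_inj_uniq ?enum_uniq.
Qed.

Lemma sum_ncommon (n p y q : nat) (f : {poly int}) : prime p -> ~~ (p %| q)%N ->
  (\sum_(b : {ffun 'I_n.+1 -> 'I_y}) ncommon f (boxu q b) p =
   \sum_(r < p | (p%:Z %| f.[r%:Z])%Z)
     #|[pred b : {ffun 'I_n.+1 -> 'I_y} | evp p r%:Z (boxv b) == - (q%:R)^-1]|)%N.
Proof.
move=> pp pq; under eq_bigr => b _ do rewrite /ncommon -sum1_card big_mkcondr /=.
rewrite exchange_big /=; apply: eq_bigr => r _.
rewrite -sum1_card [RHS]big_mkcond /=; apply: eq_bigr => b _.
rewrite -Fp_intr_eq0 // -/(evp p r (boxu q b)) /boxu evpD evpZ evp_delta.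
have q0 : q%:~R != 0 :> 'F_p by rewrite Fp_intr_eq0.
rewrite inE -[X in _ = if X then _ else _](inj_eq (mulfI q0)) mulrN mulfV //.
by rewrite addrC addr_eq0.
Qed.

(** All that the summation over primes needs to know about the norms over the box
of side [y].  It is essential that the constants depend neither on [p] nor on
[y], for [p] runs up to the size [C1 * y ^ n.+1] of the norms.  In the last
statement [e] bounds the number of residues near the faces of the box, and [s] is
a length comparable with the root of order [n.+1] of [p]. *)
Lemma nform_statistics (n : nat) (f : {poly int}) :
  f \is monic -> size f = n.+2 ->
  irreducible_poly (map_poly intr f : {poly rat}) ->
  exists q P0 C1 C2 : nat, [/\ [/\ (0 < q)%N, (0 < C1)%N, (0 < C2)%N, (2 * n.+1 <= P0)%N &
      forall p, prime p -> (p %| q)%N = (p <= P0)%N],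
    forall y (b : {ffun 'I_n.+1 -> 'I_y}),
      (`|nform f (boxu q b)| <= C1 * y ^ n.+1)%N,
    forall y p j, prime p -> (P0 < p)%N -> (0 < j)%N ->
      (#|[pred b : {ffun 'I_n.+1 -> 'I_y} | (p ^ j %| `|nform f (boxu q b)|)%N]| * p ^ j
        <= C2 * n.+1 ^ j * y ^ n.+1)%N &
    forall y p, prime p -> (P0 < p)%N -> (p <= C1 * y ^ n.+1)%N ->
      let S := (\sum_(b : {ffun 'I_n.+1 -> 'I_y}) ncommon f (boxu q b) p)%N in
      exists e s, [/\ (p * S <= nroots f p * y ^ n.+1 + p * e)%N,
        (nroots f p * y ^ n.+1 <= p * S + p * e)%N,
        (e * s ^ n <= C2 * y ^ n)%N & (p <= (C2 * s) ^ n.+1)%N]].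
Proof.
move=> fm sf firr.
have [C [C0 bnd]] := nform_bound n f; have bnd2 s' a H := (bnd s' a H).2.
have [m m0 sep] := monic_irreducible_separable fm sf firr.
(* Beyond [P0] the polynomial stays separable, [exists_scale] applies, the
   geometric series in [n.+1 / p] has ratio at most 1/2, and 2 divides [q]. *)
pose P0 := (m + C.+1 ^ n.+1 + 2 * n.+1 + 2)%N; pose q := P0`!.
have pqE p : prime p -> (p %| q)%N = (p <= P0)%N by apply: prime_dvdn_fact.
pose C1 := (C * q.+1 ^ n.+1)%N.
have q0 : (0 < q)%N by apply: fact_gt0.
have C10 : (0 < C1)%N by rewrite muln_gt0 C0 expn_gt0.
have sizeb y (b : {ffun 'I_n.+1 -> 'I_y}) : (`|nform f (boxu q b)| <= C1 * y ^ n.+1)%N.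
  have y0 : (0 < y)%N by case: y b => // b; case: (b ord0).
  rewrite /C1 -mulnA -expnMn; apply: bnd2 => i; rewrite !mxE.
  have := ltn_ord (b i); move: (nat_of_ord (b i)) => u uy.
  by case: (_ && _) => /=; nia.
have N0 y (b : {ffun 'I_n.+1 -> 'I_y}) : (0 < `|nform f (boxu q b)|)%N.
  have : ~~ (2 %| nform f (boxu q b))%Z.
    by apply: nform_coprime => //; rewrite dvdzE /= pqE //; rewrite /P0; lia.
  by rewrite absz_gt0; apply: contraNneq => ->; rewrite dvdz0.
have sy s y : (s ^ n.+1 <= C1 * y ^ n.+1)%N -> (s <= C1 * y)%N.
  move=> sC; rewrite -(leq_exp2r _ _ (ltn0Sn n)) expnMn; apply: leq_trans sC _.
  by rewrite leq_mul2r -{1}[C1]expn1 leq_pexp2l ?orbT.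
have cells s y : (s <= C1 * y)%N -> ((y %/ s).+1 * s <= C1.+1 * y)%N.
  by move=> sC; have := leq_divM y s; rewrite mulSn; lia.
have scale p j : prime p -> (P0 < p)%N -> (0 < j)%N -> (C.+1 ^ n.+1 <= p ^ j)%N.
  move=> pp Pp j0; apply: (@leq_trans p); first by rewrite /P0 in Pp; lia.
  by rewrite -{1}[p]expn1 leq_pexp2l // prime_gt0.
pose K1 := (n.+1 * 2 * (n.+1 * C * (2 * C.+1)).+1)%N.
pose C2 := ((2 * C.+1 * C1.+1) ^ n.+1 + n.+1 * K1 * C1.+1 ^ n + 2 * C.+1)%N.
exists q, P0, C1, C2; split => //.
- split => //; first by rewrite /C2; lia.
  by rewrite /P0; lia.
- move=> y p j pp Pp j0; set A := [pred b | _].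
  have [pj|pj] := leqP (p ^ j) (C1 * y ^ n.+1); last first.
    rewrite (_ : #|A| = 0%N) ?mul0n //; apply: eq_card0 => b; rewrite !inE.
    apply/negP => /(dvdn_leq (N0 _ b)) pN.
    by have := leq_trans pN (sizeb _ b); rewrite leqNgt pj.
  have [K [l [pK linj lroot]]] : exists (K : fieldType) (l : 'I_n.+1 -> K),
      [/\ p \in [pchar K], injective l & forall i, root (map_poly intr f) (l i)].
    by apply: sep => //; rewrite /P0 in Pp; lia.
  have [s0 [s [_ spos _ Cs ps]]] := exists_scale (ltn0Sn n) (scale p j pp Pp j0).
  have sC : (s <= C1 * y)%N.
    apply: sy; apply: leq_trans pj; apply: leq_trans (ltnW Cs).
    by rewrite leq_pmull.
  have pq : ~~ (p %| q)%N by rewrite pqE // -ltnNge.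
  have := card_nform_dvd y fm sf firr bnd2 pp pq pK linj lroot spos Cs.
  rewrite -/A => cardA; apply: leq_trans (leq_mul cardA (ltnW ps)) _.
  rewrite -mulnA -expnMn -[X in (_ <= X)%N]mulnA [X in (_ <= X)%N]mulnCA.
  rewrite leq_mul2l; apply/orP; right.
  apply: (@leq_trans ((2 * C.+1 * C1.+1) ^ n.+1 * y ^ n.+1)%N).
    rewrite -expnMn leq_exp2r // mulnCA -[X in (_ <= X)%N]mulnA.
    by rewrite leq_mul2l cells ?orbT.
  by rewrite leq_mul2r; apply/orP; right; rewrite /C2 -addnA leq_addr.
- move=> y p pp Pp py S.
  have Cp : (C.+1 ^ n.+1 <= p)%N by have := scale p 1%N pp Pp isT; rewrite expn1.
  have [s0 [s [ps0 spos s0s Cs ps]]] := exists_scale (ltn0Sn n) Cp.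
  have pq : ~~ (p %| q)%N by rewrite pqE // -ltnNge.
  have sC : (s <= C1 * y)%N.
    apply: sy; apply: leq_trans py; apply: leq_trans (ltnW Cs).
    by rewrite leq_pmull.
  pose e1 := (n.+1 * 2 * ((n.+1 * (C * s0)) %/ s).+1 * (y %/ s).+1 ^ n)%N.
  have cnt (r : 'I_p) : (p%:Z %| f.[r%:Z])%Z -> let c :=
      #|[pred b : {ffun 'I_n.+1 -> 'I_y} | evp p r%:Z (boxv b) == - (q%:R)^-1]| in
      (p * c <= y ^ n.+1 + p * e1)%N /\ (y ^ n.+1 <= p * c + p * e1)%N.
    move=> fr; have := near_average (e := e1)
      (h := fun b : {ffun 'I_n.+1 -> 'I_y} => evp p r%:Z (boxv b)).
    rewrite card_box (card_Fp pp); apply.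
    by move=> t t'; apply: (count_residue_le y pp fm sf firr fr ps0 spos Cs bnd).
  exists (nroots f p * e1)%N, s; split.
  + rewrite /S sum_ncommon // big_distrr /= mulnCA -mulnDr.
    rewrite /nroots -sum_nat_const; apply: leq_sum => r fr.
    by have [] := cnt r fr.
  + rewrite /S sum_ncommon // big_distrr /= mulnCA.
    rewrite /nroots -!sum_nat_const -big_split /=; apply: leq_sum => r fr.
    by have [] := cnt r fr.
  + have nr := nroots_le pp fm sf.
    have e1s : (e1 * s ^ n <= K1 * (C1.+1 * y) ^ n)%N.
      rewrite /e1 -mulnA -expnMn; apply: leq_mul; last first.
        by case: (n) => // n'; rewrite leq_exp2r // cells.
      rewrite /K1 leq_mul2l; apply/orP; right; rewrite ltnS.
      rewrite -(leq_pmul2r spos); apply: leq_trans (leq_divM _ _) _.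
      by rewrite mulnA -[X in (_ <= X)%N]mulnA leq_mul2l s0s orbT.
    rewrite -mulnA; apply: leq_trans (leq_mul nr e1s) _.
    rewrite expnMn 2!mulnA leq_mul2r; apply/orP; right.
    by rewrite /C2 [X in (_ <= X + _)%N]addnC -addnA leq_addr.
  + apply: leq_trans (ltnW ps) _; rewrite leq_exp2r // leq_mul2r; apply/orP; right.
    by rewrite /C2 leq_addl.
Qed.

(** * The size of the norms over a box *)

(** Two such points are at distance less than [2 * e], hence have different indices
modulo [2 * e] unless they coincide. *)
Lemma card_near_point (y q e : nat) (z : algC) : (0 < q)%N ->
  (#|[pred x : 'I_y | (`|(1 + q%:Z * x%:Z)%:~R - z| < e%:R)%R]| <= 2 * e)%N.
Proof.
move=> q0; have [->|e0] := posnP e.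
  by rewrite eq_card0 // => x; rewrite !inE normr_lt0.
have e20 : (0 < 2 * e)%N by rewrite muln_gt0.
pose h (x : 'I_y) := Ordinal (ltn_pmod x e20).
have hinj : {in [pred x : 'I_y | (`|(1 + q%:Z * x%:Z)%:~R - z| < e%:R)%R] &, injective h}.
  move=> x x'; rewrite !inE => xz x'z [/= xx'].
  have dist : `|(q%:Z * (x%:Z - x'%:Z))%:~R| < (2 * e)%:R :> algC.
    have -> : (q%:Z * (x%:Z - x'%:Z))%:~R =
       ((1 + q%:Z * x%:Z)%:~R - z) - ((1 + q%:Z * x'%:Z)%:~R - z) :> algC.
      by rewrite opprB addrA subrK -intrB opprD addrACA subrr add0r mulrBr.
    apply: le_lt_trans (ler_normB _ _) _.
    by rewrite natrM mulr_natl mulr2n ltrD.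
  have {}dist : (`|(q%:Z * (x%:Z - x'%:Z))%R| < 2 * e)%N.
    by move: dist; rewrite -intr_norm -abszE -pmulrn ltr_nat.
  apply: val_inj => /=; move: dist xx'; rewrite abszM /=.
  move: (nat_of_ord x) (nat_of_ord x') => u v dist uv.
  have {}dist : (`|(u%:Z - v%:Z)%R| < 2 * e)%N by apply: leq_ltn_trans dist; rewrite leq_pmull.
  have := divn_eq u (2 * e); have := divn_eq v (2 * e); rewrite uv.
  move: (u %/ (2 * e))%N (v %/ (2 * e))%N (v %% (2 * e))%N => a b c.
  move: (2 * e)%N dist => E dist ub vb.
  have [ab|ab|ab] := ltngtP a b; last by rewrite ub vb ab.
    have : (a.+1 * E <= b * E)%N by rewrite leq_mul2r ab orbT.
    by rewrite mulSn; lia.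
  have : (b.+1 * E <= a * E)%N by rewrite leq_mul2r ab orbT.
  by rewrite mulSn; lia.
rewrite -(card_in_image hinj); apply: leq_trans (max_card _) _.
by rewrite card_ord.
Qed.

(** Each root excludes few arguments, so a monic polynomial is large at one of any
[2 * d * e + 1] arguments. *)
Lemma monic_large_value (y q e d : nat) (P : {poly int}) (S : {pred 'I_y}) :
  (0 < q)%N -> P \is monic -> size P = d.+1 -> (2 * e * d < #|S|)%N ->
  exists2 x, x \in S & (e ^ d <= `|P.[(1 + q%:Z * x%:Z)%R]|)%N.
Proof.
move=> q0 Pm sP cS; pose PC : {poly algC} := map_poly intr P.
have [rs] := closed_field_poly_normal PC.
have PCm : PC \is monic by apply: monic_map.
rewrite (monicP PCm) scale1r => PCE.
have srs : size rs = d.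
  have : size PC = d.+1 by rewrite size_map_poly_id0 // (monicP Pm) oner_eq0.
  by rewrite PCE size_prod_XsubC => -[].
have [x xS xfar] : exists2 x, x \in S &
    all (fun z : algC => e%:R <= `|(1 + q%:Z * x%:Z)%:~R - z|) rs.
  apply/exists_inP; apply: contraTT cS; rewrite negb_exists_in => /forall_inP near.
  rewrite -leqNgt -srs.
  have : (#|S| <= \sum_(z <- rs) #|[pred x : 'I_y | (`|(1 + q%:Z * x%:Z)%:~R - z| < e%:R)%R]|)%N.
    rewrite -sum1_card; under [leqRHS]eq_bigr => z _ do rewrite -sum1_card big_mkcond.
    rewrite exchange_big big_mkcond /=; apply: leq_sum => x _; case: ifP => // xS.
    have /allPn[z zrs zx] := near x xS.
    have zx' : `|(1 + q%:Z * x%:Z)%:~R - z| < e%:R by rewrite real_ltNge // ?normr_real ?realn.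
    by rewrite (big_rem z) //= inE zx' leq_addr.
  move=> /leq_trans; apply; apply: (@leq_trans (\sum_(z <- rs) 2 * e)%N).
    by apply: leq_sum => z _; apply: card_near_point.
  by rewrite big_const_seq count_predT iter_addn_0.
exists x => //; rewrite -(ler_nat algC) natrX [leRHS]pmulrn abszE intr_norm.
have -> : (P.[1 + q%:Z * x%:Z])%:~R = \prod_(z <- rs) ((1 + q%:Z * x%:Z)%:~R - z) :> algC.
  by rewrite -horner_map /= -/PC PCE horner_prod; apply: eq_bigr => z _; rewrite hornerXsubC.
rewrite normr_prod -srs -[size rs]count_predT.
have -> : e%:R ^+ count predT rs = \prod_(z <- rs) e%:R :> algC.
  by rewrite big_const_seq iter_mulr_1.
by rewrite big_seq [leRHS]big_seq; apply: ler_prod => z zrs; rewrite ler0n (allP xfar).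
Qed.

(** Remove a point where [v] is large, and repeat. *)
Lemma greedy_sum_ge (R : numDomainType) (T : finType) (v : T -> R) (g : nat -> R) :
  (forall S : {pred T}, (0 < #|S|)%N -> exists2 x, x \in S & g #|S|.-1 <= v x) ->
  forall S : {pred T}, \sum_(m < #|S|) g m <= \sum_(x in S) v x.
Proof.
move=> H S; move: {2}#|S| (erefl #|S|) => c; elim: c S => [|c IH] S cS.
  rewrite cS big_ord0 big1 // => x xS.
  by have := card0_eq cS x; rewrite inE xS.
have [|x xS gx] := H S; first by rewrite cS.
have cS' : #|[predD1 S & x]| = c by have := cardD1 x S; rewrite xS cS => -[].
rewrite cS big_ord_recr /= (bigD1 x) //= addrC; apply: lerD.
  by rewrite cS in gx.
have E : \sum_(i in [predD1 S & x]) v i = \sum_(i in S | i != x) v i.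
  by apply: eq_bigl => i; rewrite !inE andbC.
by have := IH _ cS'; rewrite cS' E.
Qed.

Lemma ln_le_subr1 (R : realType) (x : R) : 0 < x -> ln x <= x - 1.
Proof.
move=> x0; have := @le_ln1Dx R (x - 1).
by rewrite (_ : 1 + (x - 1) = x); [apply; lra | ring].
Qed.

Lemma sum_ln_ge (R : realType) (y : nat) :
  y%:R * ln y%:R - y%:R <= \sum_(m < y) ln (m.+1)%:R :> R.
Proof.
elim: y => [|y IH]; first by rewrite big_ord0 mul0r subrr.
rewrite big_ord_recr /=; apply: le_trans (lerD IH (lexx _)).
have [->|y0] := posnP y; first by rewrite ln1 mul0r mulr0; lra.
have yR : 0 < y%:R :> R by rewrite ltr0n.
have y1R : 0 < (y.+1)%:R :> R by rewrite ltr0n.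
have h : ln (y.+1)%:R - ln y%:R <= y%:R^-1 :> R.
  rewrite -ln_div ?posrE //; apply: le_trans (ln_le_subr1 (divr_gt0 _ _)) _ => //.
  by rewrite -natr1 mulrDl mulfV ?gt_eqF // mul1r addrC addKr.
have {h} : y%:R * (ln (y.+1)%:R - ln y%:R) <= 1 :> R.
  by rewrite -ler_pdivlMl // mulr1.
by rewrite -natr1; nra.
Qed.

(** Among [m] values of a monic polynomial of degree [d], one is of order [m ^ d];
removing values one by one produces [d] times the logarithm of a factorial. *)
Lemma monic_sum_ln_ge (R : realType) (y q d : nat) (P : {poly int}) :
  (0 < q)%N -> (0 < d)%N -> P \is monic -> size P = d.+1 ->
  (forall x : 'I_y, P.[1 + q%:Z * x%:Z] != 0) ->
  d%:R * (y%:R * (ln y%:R - (1 + ln (4 * d)%:R))) <=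
    \sum_(x < y) ln (`|P.[1 + q%:Z * x%:Z]|%N)%:R :> R.
Proof.
move=> q0 d0 Pm sP Pn0.
pose g (m : nat) : R := d%:R * (ln (m.+1)%:R - ln (4 * d)%:R).
have d4 : 0 < (4 * d)%:R :> R by rewrite ltr0n muln_gt0.
have := @greedy_sum_ge R 'I_y (fun x => ln (`|P.[1 + q%:Z * x%:Z]|%N)%:R) g.
move=> /(_ _ predT) H.
have {H} H : \sum_(m < y) g m <= \sum_(x < y) ln (`|P.[1 + q%:Z * x%:Z]|%N)%:R.
  have := H; rewrite (eq_card (B := 'I_y)) // card_ord; apply => S S0.
  pose e := maxn 1 (#|S|.-1 %/ (2 * d)).
  have [x xS ex] : exists2 x, x \in S & (e ^ d <= `|P.[(1 + q%:Z * x%:Z)%R]|)%N.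
    have [e1|e1] := leqP (#|S|.-1 %/ (2 * d)) 1.
      case/card_gt0P: S0 => x xS; exists x => //.
      by rewrite /e (maxn_idPl e1) exp1n absz_gt0.
    apply: monic_large_value sP _ => //.
    rewrite /e (maxn_idPr (ltnW e1)) (mulnC 2%N) -mulnA.
    by apply: leq_ltn_trans (leq_divM _ _) _; rewrite prednK.
  exists x => //; rewrite /g.
  have e0 : (0 < e)%N by rewrite /e; lia.
  have Pe : ln ((e ^ d)%N%:R) <= ln (`|P.[1 + q%:Z * x%:Z]|%N)%:R :> R.
    by rewrite ler_ln ?posrE ?ltr0n ?expn_gt0 ?e0 ?absz_gt0 // ler_nat.
  apply: le_trans Pe; rewrite natrX lnXn ?ltr0n // -[leRHS]mulr_natl.
  apply: ler_wpM2l; first exact: ler0n.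
  have eR : 0 < e%:R :> R by rewrite ltr0n.
  rewrite lerBlDr -lnM ?posrE // -natrM ler_ln ?posrE ?ltr0n ?muln_gt0 ?e0 ?d0 //.
  rewrite ler_nat.
  have d20 : (0 < 2 * d)%N by rewrite muln_gt0.
  rewrite /e; set w := #|S|.-1; have := divn_eq w (2 * d); have := ltn_pmod w d20.
  set u := (w %/ (2 * d))%N; set v := (w %% (2 * d))%N => vd wE.
  have [u1|u1] := leqP u 1.
    by move: (w) (u) (v) u1 vd wE; clear; nia.
  by move: (w) (u) (v) u1 vd wE; clear; nia.
apply: le_trans H; rewrite -mulr_sumr; apply: ler_wpM2l; first exact: ler0n.
rewrite sumrB sumr_const card_ord -[X in _ <= _ - X]mulr_natl.
have := sum_ln_ge R y; set A := \sum_(_ < _) _; set B := ln _; set B' := ln _.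
by move=> h; lra.
Qed.

Definition upd0 (n y : nat) (b : {ffun 'I_n.+1 -> 'I_y}) (x : 'I_y) :
  {ffun 'I_n.+1 -> 'I_y} := [ffun i => if i == ord0 then x else b i].

(** Averaging along lines parallel to the first axis. *)
Lemma sum_upd0 (R : pzRingType) (n y : nat) (F : {ffun 'I_n.+1 -> 'I_y} -> R) :
  \sum_b \sum_x F (upd0 b x) = y%:R * \sum_b F b.
Proof.
(* Exchanging the first coordinate of [b] with [x] is an involution on pairs. *)
pose h (u : {ffun 'I_n.+1 -> 'I_y} * 'I_y) := (upd0 u.1 u.2, u.1 ord0).
have hK : involutive h.
  move=> [b x]; rewrite /h /=; congr pair; last by rewrite ffunE eqxx.
  by apply/ffunP => i; rewrite !ffunE; case: eqP => [->|].
rewrite pair_bigA /= (reindex_inj (inv_inj hK)) /=.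
rewrite (eq_bigr (fun u => F u.1)); last first.
  by move=> u _; congr F; have := hK u; rewrite /h; case: u => b x [].
rewrite -(pair_bigA _ (fun b (x : 'I_y) => F b)) /= mulr_sumr; apply: eq_bigr => b _.
by rewrite sumr_const card_ord mulr_natl.
Qed.

(** On lines parallel to the first axis the norm form is a monic polynomial. *)
Lemma sum_ln_nform_ge (R : realType) (n y q : nat) (f : {poly int}) :
  (2 %| q)%N -> (0 < q)%N ->
  y%:R ^+ n.+1 * (n.+1%:R * (ln y%:R - (1 + ln (4 * n.+1)%:R))) <=
    \sum_(b : {ffun 'I_n.+1 -> 'I_y}) ln (`|nform f (boxu q b)|%N)%:R :> R.
Proof.
move=> q2 q0; set d := n.+1; have [->|y0] := posnP y.
  rewrite expr0n /= mul0r big1 // => b; by case: (b ord0).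
have yR : 0 < y%:R :> R by rewrite ltr0n.
rewrite -(ler_pM2l yR) -sum_upd0.
have -> : y%:R * (y%:R ^+ d * (d%:R * (ln y%:R - (1 + ln (4 * d)%:R)))) =
    \sum_(b : {ffun 'I_d -> 'I_y}) d%:R * (y%:R * (ln y%:R - (1 + ln (4 * d)%:R))) :> R.
  by rewrite sumr_const card_box -[RHS]mulr_natl natrX; ring.
apply: ler_sum => b _.
pose P := char_poly (- krylov (companion n f) (q%:Z *: (boxv b - (b ord0)%:Z *: delta_mx 0 0))).
have PE (x : 'I_y) : nform f (boxu q (upd0 b x)) = P.[1 + q%:Z * x%:Z].
  rewrite -nform_char_poly; congr nform; apply/rowP => i; rewrite !mxE ffunE /=.
  by case: eqP => [->|_] /=; ring.
under [leRHS]eq_bigr => x _ do rewrite PE.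
apply: monic_sum_ln_ge => //.
- exact: char_poly_monic.
- by rewrite size_char_poly.
move=> x; rewrite -PE; have := @nform_coprime n f 2 q (boxv (upd0 b x)) isT.
by rewrite dvdzE => /(_ q2); apply: contraNneq; rewrite -/(boxu q _) => ->.
Qed.

Lemma sum_ln_nform_le (R : realType) (n y q C1 : nat) (f : {poly int}) :
  (0 < C1)%N -> (0 < y)%N ->
  (forall b : {ffun 'I_n.+1 -> 'I_y}, (0 < `|nform f (boxu q b)|)%N) ->
  (forall b : {ffun 'I_n.+1 -> 'I_y}, (`|nform f (boxu q b)| <= C1 * y ^ n.+1)%N) ->
  \sum_(b : {ffun 'I_n.+1 -> 'I_y}) ln (`|nform f (boxu q b)|%N)%:R <=
  y%:R ^+ n.+1 * (n.+1%:R * ln y%:R + ln C1%:R) :> R.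
Proof.
move=> C10 y0 N0 NC.
have -> : y%:R ^+ n.+1 * (n.+1%:R * ln y%:R + ln C1%:R) =
    \sum_(b : {ffun 'I_n.+1 -> 'I_y}) (n.+1%:R * ln y%:R + ln C1%:R) :> R.
  by rewrite sumr_const card_box -[RHS]mulr_natl natrX.
apply: ler_sum => b _.
rewrite [n.+1%:R * _]mulr_natl -lnXn ?ltr0n // addrC -lnM ?posrE ?exprn_gt0 ?ltr0n //.
rewrite -natrX -natrM ler_ln ?posrE ?ltr0n ?muln_gt0 ?expn_gt0 ?C10 ?y0 ?N0 //.
by rewrite ler_nat.
Qed.

(** * Chebyshev's bound and sums over primes *)

Lemma dvdn_prod_primes (a b m : nat) :
  (forall p, prime p -> (a <= p < b)%N -> (p %| m)%N) ->
  (\prod_(a <= p < b | prime p) p %| m)%N.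
Proof.
elim: b => [|b IH] H; first by rewrite big_geq // dvd1n.
have [ab|ba] := leqP a b; last by rewrite big_geq // dvd1n.
rewrite big_mkcond big_nat_recr //= -big_mkcond /=.
have {}IH : (\prod_(a <= p < b | prime p) p %| m)%N.
  by apply: IH => p pp /andP[ap pb]; apply: H; rewrite // ap ltnW.
case: ifP => pb; last by rewrite muln1.
rewrite Gauss_dvd ?IH ?H ?ab ?leqnn // coprime_sym prime_coprime //.
rewrite big_seq_cond; elim/big_ind: _ => [|x y Hx Hy|p].
- by apply/negP => /dvdn_leq -/(_ isT); have := prime_gt1 pb; lia.
- by rewrite Euclid_dvdM // negb_or Hx.
- rewrite mem_index_iota => /andP[/andP[_ pltb] pp].
  by apply/negP => /dvdn_leq -/(_ (prime_gt0 pp)); lia.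
Qed.

Lemma bin_central_le (m : nat) : ('C(m.*2.+1, m) <= 4 ^ m)%N.
Proof.
have S : (\sum_(i < m.*2.+2) 'C(m.*2.+1, i) = 2 ^ m.*2.+1)%N.
  by rewrite -[2%N]/(1 + 1)%N expnDn; apply: eq_bigr => i _; rewrite !exp1n !muln1.
have i0 : (m < m.*2.+2)%N by lia.
have i1 : (m.+1 < m.*2.+2)%N by lia.
have : ('C(m.*2.+1, m) + 'C(m.*2.+1, m.+1) <= 2 ^ m.*2.+1)%N.
  rewrite -S (bigD1 (Ordinal i0)) //= leq_add2l (bigD1 (Ordinal i1)) /= ?leq_addr //.
  by rewrite -val_eqE /= gtn_eqF.
have -> : 'C(m.*2.+1, m.+1) = 'C(m.*2.+1, m).
  by rewrite -[in RHS]bin_sub; [congr 'C(_, _); lia | lia].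
by rewrite addnn -mul2n expnS leq_pmul2l // -mul2n expnM.
Qed.

(** The primes from [m.+2] to [m.*2.+1] divide a central binomial coefficient. *)
Lemma primorial_le (n : nat) : (\prod_(0 <= p < n.+1 | prime p) p <= 4 ^ n)%N.
Proof.
elim/ltn_ind: n => -[|[|[|n]]] IH; try by rewrite !big_mkcond /= unlock.
case/boolP: (odd n.+3) => on.
  have [m nm] : exists m, n.+3 = m.*2.+1.
    by exists n.+3./2; rewrite -[LHS]odd_double_half on.
  rewrite nm (big_cat_nat (n := m.+2)) //=; last by lia.
  have -> : (4 ^ m.*2.+1 = 4 ^ m.+1 * 4 ^ m)%N by rewrite -expnD; congr expn; lia.
  apply: leq_mul; first by apply: IH; lia.
  apply: leq_trans (bin_central_le m); apply: dvdn_leq.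
    by rewrite bin_gt0; lia.
  apply: dvdn_prod_primes => p pp /andP[mp p2m].
  have := bin_fact (_ : m <= m.*2.+1)%N; rewrite (_ : m.*2.+1 - m = m.+1)%N; last by lia.
  move=> bf; have {bf} bf : ('C(m.*2.+1, m) * (m`! * m.+1`!) = m.*2.+1`!)%N by apply: bf; lia.
  have : (p %| m.*2.+1`!)%N by apply: dvdn_fact; rewrite prime_gt0.
  rewrite -bf Euclid_dvdM // => /orP[//|].
  by rewrite Euclid_dvdM // => /orP[]; rewrite prime_dvdn_fact //; lia.
rewrite big_mkcond big_nat_recr //= -big_mkcond /= ifN; last first.
  apply: contra on => pn; have [|//] := even_prime pn; lia.
rewrite muln1; apply: leq_trans (IH n.+2 _) _; rewrite ?leq_exp2l //.
Qed.

Lemma ln_prod_nat (R : realType) (I : Type) (r : seq I) (P : pred I) (F : I -> nat) :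
  (forall i, P i -> (0 < F i)%N) ->
  ln ((\prod_(i <- r | P i) F i)%N)%:R = \sum_(i <- r | P i) ln (F i)%:R :> R.
Proof.
move=> F0; elim: r => [|i r IH]; first by rewrite !big_nil ln1.
rewrite !big_cons; case: ifP => // Pi.
by rewrite natrM lnM ?IH // posrE ltr0n ?F0 // prodn_cond_gt0.
Qed.

(** Chebyshev's upper bound. *)
Lemma theta_le (R : realType) (n : nat) :
  \sum_(0 <= p < n.+1 | prime p) ln p%:R <= n%:R * ln 4%:R :> R.
Proof.
rewrite -ln_prod_nat; last by move=> p; apply: prime_gt0.
rewrite mulr_natl -lnXn ?ltr0n // -natrX ler_ln ?posrE ?ltr0n ?expn_gt0 //.
  by rewrite ler_nat primorial_le.
by rewrite prodn_cond_gt0 // => p; apply: prime_gt0.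
Qed.

(** Summation by parts. *)
Lemma abel_sum_le (R : realType) (a w : nat -> R) (m n : nat) (D : R) :
  (m <= n)%N -> (forall k, (m <= k)%N -> \sum_(m <= i < k) a i <= D) ->
  (forall i, (m <= i)%N -> w i.+1 <= w i) -> (forall i, (m <= i)%N -> 0 <= w i) ->
  \sum_(m <= i < n) a i * w i <= D * w m.
Proof.
move=> mn aD wd w0.
suff H : \sum_(m <= i < n) a i * w i <=
    (\sum_(m <= i < n) a i) * w n + D * (w m - w n).
  apply: le_trans H _; have := aD n mn; have := w0 n mn.
  by move: (\sum_(m <= i < n) a i) => A; nra.
elim: n mn => [|n IH].
  by rewrite leqn0 => /eqP ->; rewrite !big_geq // mul0r subrr mulr0 addr0.
rewrite leq_eqVlt => /orP[/eqP <-|]; first by rewrite !big_geq // mul0r subrr mulr0 addr0.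
rewrite ltnS => mn; have aDn := aD n.+1 (leqW mn).
rewrite !big_nat_recr //= in aDn *; have := IH mn; have := wd n mn.
by move: aDn; move: (\sum_(_ <= _ < _) _) (\sum_(_ <= _ < _) _) => A B; nra.
Qed.

(** By Chebyshev's bound and summation by parts, [ln p] on the primes weighs no
more against a nonincreasing function than the constant [ln 4] on the integers. *)
Lemma prime_sum_le (R : realType) (g : nat -> R) (N : nat) :
  (forall i, (0 < i)%N -> g i.+1 <= g i) -> (forall i, (0 < i)%N -> 0 <= g i) ->
  \sum_(0 <= p < N.+1 | prime p) ln p%:R * g p <= ln 4%:R * \sum_(1 <= i < N.+1) g i.
Proof.
move=> gd g0.
pose a (i : nat) : R := (if prime i then ln i%:R else 0) - ln 4%:R.
have H := @abel_sum_le R a g 1 N.+1 0 isT _ gd g0.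
have {H} : \sum_(1 <= i < N.+1) a i * g i <= 0.
  rewrite -[leRHS](mul0r (g 1%N)); apply: H => -[//|k] _.
  rewrite sumrB sumr_const_nat subSS subn0 subr_le0 -[leRHS]mulr_natl.
  apply: le_trans (theta_le R k).
  by rewrite [leRHS]big_mkcond [leRHS]big_ltn //= add0r.
under eq_bigr => i _ do rewrite mulrBl.
rewrite sumrB -mulr_sumr subr_le0; apply: le_trans.
rewrite big_mkcond big_ltn //= add0r; apply: ler_sum => i _.
by case: ifP => // _; rewrite mul0r.
Qed.

Lemma nat_root (R : realType) (d : nat) : (0 < d)%N ->
  exists t : nat -> R, (forall i, 0 <= t i) /\ (forall i, t i ^+ d = i%:R).
Proof.
move=> d0; exists (fun i => i%:R `^ (d%:R^-1)); split; first by move=> i; apply: powR_ge0.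
move=> i; rewrite -powR_mulrn ?powR_ge0 // -powRrM mulVf ?powRr1 ?ler0n //.
by rewrite pnatr_eq0 -lt0n.
Qed.

(** With [t i] the root of order [n.+1] of [i], the sum is compared with a
telescoping one: [t i.+1 ^+ n.+1 - t i ^+ n.+1 = 1]. *)
Lemma sum_inv_root_le (R : realType) (n N : nat) (t : nat -> R) :
  (forall i, 0 <= t i) -> (forall i, t i ^+ n.+1 = i%:R) ->
  \sum_(1 <= i < N.+1) (t i ^+ n)^-1 <= n.+1%:R * t N.
Proof.
move=> t0 tE; rewrite big_add1 /=.
have t00 : t 0%N = 0.
  by apply/eqP; have := tE 0%N => /eqP; rewrite expf_eq0 => /andP[].
have -> : n.+1%:R * t N = \sum_(0 <= i < N) n.+1%:R * (t i.+1 - t i).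
  by rewrite -mulr_sumr telescope_sumr // t00 subr0.
apply: ler_sum => i _; have ti : 0 < t i.+1.
  rewrite lt_neqAle t0 andbT eq_sym; apply/eqP => ti0.
  by have := tE i.+1; rewrite ti0 expr0n /= => /esym/eqP; rewrite pnatr_eq0.
have tile : t i <= t i.+1.
  by rewrite -(@ler_pXn2r _ n.+1) ?nnegrE // !tE ler_nat.
rewrite -[leLHS]mul1r ler_pdivrMr ?exprn_gt0 //.
have E1 : 1 = t i.+1 ^+ n.+1 - t i ^+ n.+1 by rewrite !tE -natrB // subSnn.
rewrite [leLHS]E1 subrXX -[leRHS]mulrA [leRHS]mulrCA; apply: ler_wpM2l; first by rewrite subr_ge0.
rewrite mulr_natl -[X in _ *+ X]card_ord -sumr_const; apply: ler_sum => j _.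
rewrite /= -[X in _ <= _ ^+ X](@subnK j n) ?exprD; last by have := ltn_ord j; lia.
apply: ler_wpM2l; first exact: exprn_ge0.
by rewrite lerXn2r ?nnegrE.
Qed.

Lemma sum_inv_sqr_le (R : realType) (m N : nat) : (0 < m)%N ->
  \sum_(m <= i < N) (i%:R ^+ 2)^-1 <= 2 / m%:R :> R.
Proof.
move=> m0; have m2 : 0 <= 2 / m%:R :> R by rewrite divr_ge0 // ler0n.
have [Nm|mN] := leqP N m; first by rewrite big_geq.
apply: (@le_trans _ _ (\sum_(m <= i < N) (- (2 / i.+1%:R) - - (2 / i%:R)))); last first.
  rewrite telescope_sumr ?(ltnW mN) // opprK addrC gerBl divr_ge0 //.
rewrite big_nat [leRHS]big_nat; apply: ler_sum => i /andP[mi _].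
have i1 : 1 <= i%:R :> R by rewrite ler1n; lia.
rewrite -[i.+1%:R]natr1; move: (i%:R) i1 => x x1.
have x0 : 0 < x by lra.
rewrite expr2 invfM.
have a0 : 0 < x^-1 by rewrite invr_gt0.
have b0 : 0 < (x + 1)^-1 by rewrite invr_gt0; lra.
have xa : x * x^-1 = 1 by rewrite mulfV // gt_eqF.
have xb : (x + 1) * (x + 1)^-1 = 1 by rewrite mulfV // gt_eqF //; lra.
move: (x^-1) ((x + 1)^-1) a0 b0 xa xb => a b a0 b0 xa xb.
have E : a - b = a * b.
  have -> : a - b = (a * ((x + 1) * b) - b * (x * a)) by rewrite xa xb !mulr1.
  by ring.
have ab : a <= 2 * b.
  have -> : a = a * ((x + 1) * b) by rewrite xb mulr1.
  have -> : a * ((x + 1) * b) = (x * a) * b + a * b by ring.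
  by rewrite xa; nra.
have := ler_wpM2l (ltW a0) ab; have -> : a * (2 * b) = 2 * (a * b) by ring.
by rewrite -E; lra.
Qed.

Lemma geometric_tail_le (R : realType) (x : R) (J : nat) : 0 <= x -> x <= 2^-1 ->
  \sum_(2 <= j < J) x ^+ j <= 2 * x ^+ 2.
Proof.
move=> x0 x2; have x20 : 0 <= x ^+ 2 by apply: exprn_ge0.
have [J2|J2] := leqP J 2; first by rewrite big_geq // mulr_ge0.
suff : \sum_(2 <= j < J) x ^+ j <= 2 * x ^+ 2 - 2 * x ^+ J.
  by move=> /le_trans; apply; rewrite gerBl mulr_ge0 // exprn_ge0.
elim: J J2 => // J IH; rewrite ltnS leq_eqVlt => /orP[/eqP <-|J2].
  by rewrite big_nat1 (exprS x 2); move: (x ^+ 2) x20 => X X0; nra.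
rewrite big_nat_recr //=; last exact: ltnW.
have := IH J2; rewrite (exprS x J); have : 0 <= x ^+ J by apply: exprn_ge0.
by move: (\sum_(_ <= _ < _) _) (x ^+ J) => A B; nra.
Qed.

(** * Nagell's theorem *)

Lemma logn_sum_upper (n y q p : nat) (f : {poly int}) (J : nat) :
  prime p -> f \is monic -> size f = n.+2 ->
  (forall b : {ffun 'I_n.+1 -> 'I_y}, (`|nform f (boxu q b)| < p ^ J)%N) ->
  (\sum_(b : {ffun 'I_n.+1 -> 'I_y}) logn p `|nform f (boxu q b)| <=
   \sum_(b : {ffun 'I_n.+1 -> 'I_y}) ncommon f (boxu q b) p +
   2 * \sum_(2 <= j < J)
     #|[pred b : {ffun 'I_n.+1 -> 'I_y} | (p ^ j %| `|nform f (boxu q b)|)%N]|)%N.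
Proof.
move=> pp fm sf NJ.
under [X in (_ <= _ + 2 * X)%N]eq_bigr => j _ do rewrite -sum1_card big_mkcond /=.
rewrite exchange_big /= big_distrr -big_split /=; apply: leq_sum => b _.
apply: leq_trans (logn_nform_le pp fm sf (NJ b)) _.
rewrite leq_add2l leq_mul2l /=; apply: leq_sum => j _.
by rewrite inE; case: (_ %| _)%N.
Qed.

Lemma logn_sum_lower (n y q p : nat) (f : {poly int}) :
  prime p -> f \is monic -> size f = n.+2 ->
  (forall b : {ffun 'I_n.+1 -> 'I_y}, (0 < `|nform f (boxu q b)|)%N) ->
  (\sum_(b : {ffun 'I_n.+1 -> 'I_y}) ncommon f (boxu q b) p <=
   \sum_(b : {ffun 'I_n.+1 -> 'I_y}) logn p `|nform f (boxu q b)|)%N.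
Proof.
move=> pp fm sf N0; apply: leq_sum => b _; rewrite -pfactor_dvdn //.
by have := dvd_nform_ncommon (boxu q b) pp fm sf; rewrite dvdzE.
Qed.

(** The first error term comes from the faces of the box, the second one from the
powers [p ^ j] with [j >= 2]; both are summable against [ln p]. *)
Lemma valuation_sum_near (R : realType) (n y q p P0 C1 C2 : nat)
    (f : {poly int}) (t : R) :
  prime p -> f \is monic -> size f = n.+2 -> (0 < y)%N ->
  (2 * n.+1 <= P0)%N -> (P0 < p)%N -> 0 <= t -> t ^+ n.+1 = p%:R ->
  (forall b : {ffun 'I_n.+1 -> 'I_y}, (0 < `|nform f (boxu q b)|)%N) ->
  (forall b : {ffun 'I_n.+1 -> 'I_y}, (`|nform f (boxu q b)| <= C1 * y ^ n.+1)%N) ->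
  (forall j, (0 < j)%N ->
    (#|[pred b : {ffun 'I_n.+1 -> 'I_y} | (p ^ j %| `|nform f (boxu q b)|)%N]| * p ^ j
      <= C2 * n.+1 ^ j * y ^ n.+1)%N) ->
  (let S := (\sum_(b : {ffun 'I_n.+1 -> 'I_y}) ncommon f (boxu q b) p)%N in
      exists e s, [/\ (p * S <= nroots f p * y ^ n.+1 + p * e)%N,
        (nroots f p * y ^ n.+1 <= p * S + p * e)%N,
        (e * s ^ n <= C2 * y ^ n)%N & (p <= (C2 * s) ^ n.+1)%N]) ->
  `|(\sum_(b : {ffun 'I_n.+1 -> 'I_y}) logn p `|nform f (boxu q b)|)%N%:R -
      y%:R ^+ n.+1 * ((nroots f p)%:R / p%:R)| <=
    (C2%:R ^+ n.+1 * y%:R ^+ n) * (t ^+ n)^-1 +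
    (4 * C2%:R * n.+1%:R ^+ 2 * y%:R ^+ n.+1) * (p%:R ^+ 2)^-1.
Proof.
move=> pp fm sf y0 dP Pp t0 tE N0 NC cnt [e [s [Se1 Se2 es ps]]].
set V := (\sum_b logn p _)%N; set S := (\sum_b ncommon _ _ _)%N in Se1 Se2.
have p0 : 0 < p%:R :> R by rewrite ltr0n prime_gt0.
have tpos : 0 < t.
  rewrite lt_neqAle t0 andbT eq_sym; apply: contraTneq p0 => t00.
  by rewrite -tE t00 expr0n /= ltxx.
have yR : 0 < y%:R :> R by rewrite ltr0n.
pose J := (C1 * y ^ n.+1).+1.
have SV : (S <= V)%N by apply: logn_sum_lower.
have VS : (V <= S + 2 * \sum_(2 <= j < J)
    #|[pred b : {ffun 'I_n.+1 -> 'I_y} | (p ^ j %| `|nform f (boxu q b)|)%N]|)%N.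
  apply: logn_sum_upper => // b; apply: leq_ltn_trans (NC b) _.
  by apply: ltnW; apply: ltn_expl (prime_gt1 pp).
set W := (\sum_(2 <= j < J) _)%N in VS.
have We : W%:R <= 2 * C2%:R * n.+1%:R ^+ 2 * y%:R ^+ n.+1 / p%:R ^+ 2 :> R.
  pose x : R := n.+1%:R / p%:R.
  have x0 : 0 <= x by rewrite divr_ge0.
  have x2 : x <= 2^-1.
    rewrite /x ler_pdivrMr // mulrC ler_pdivlMr // -natrM ler_nat.
    by apply: leq_trans (ltnW Pp); rewrite mulnC.
  apply: (@le_trans _ _ (C2%:R * y%:R ^+ n.+1 * \sum_(2 <= j < J) x ^+ j)).
    rewrite natr_sum mulr_sumr big_nat [leRHS]big_nat; apply: ler_sum => j /andP[j2 _].
    have j0 : (0 < j)%N by lia.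
    rewrite expr_div_n mulrA ler_pdivlMr ?exprn_gt0 //.
    have := cnt j j0; rewrite -(ler_nat R) !natrM !natrX => /le_trans; apply.
    by rewrite mulrAC.
  apply: le_trans (ler_wpM2l _ (geometric_tail_le J x0 x2)) _.
    by rewrite mulr_ge0 // exprn_ge0 // ltW.
  by rewrite /x expr_div_n le_eqVlt; apply/orP; left; apply/eqP; ring.
have ee : e%:R <= C2%:R ^+ n.+1 * y%:R ^+ n * (t ^+ n)^-1 :> R.
  rewrite ler_pdivlMr ?exprn_gt0 //.
  have ts : t <= C2%:R * s%:R.
    rewrite -(@ler_pXn2r _ n.+1) ?nnegrE ?mulr_ge0 // tE -natrM -natrX ler_nat.
    exact: ps.
  have tsn : t ^+ n <= (C2%:R * s%:R) ^+ n by rewrite lerXn2r ?nnegrE ?mulr_ge0.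
  apply: le_trans (ler_wpM2l _ tsn) _ => //.
  rewrite exprMn mulrCA exprSr -[leRHS]mulrA; apply: ler_wpM2l; first exact: exprn_ge0.
  by rewrite -!natrX -!natrM ler_nat.
have Se : `|S%:R - y%:R ^+ n.+1 * ((nroots f p)%:R / p%:R)| <= e%:R :> R.
  rewrite -(ler_pM2l p0) -[X in X * `|_|]gtr0_norm // -normrM mulrBr.
  have -> : p%:R * (y%:R ^+ n.+1 * ((nroots f p)%:R / p%:R)) = (nroots f p)%:R * y%:R ^+ n.+1 :> R.
    by field; rewrite gt_eqF.
  move: Se1 Se2; rewrite -!(ler_nat R) !natrD !natrM natrX => h1 h2.
  by rewrite ler_norml; apply/andP; split; lra.
have VSR : S%:R <= V%:R :> R by rewrite ler_nat.
have VSR' : V%:R <= S%:R + 2 * W%:R :> R by rewrite -natrM -natrD ler_nat.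
move: Se; rewrite !ler_norml => /andP[h1 h2].
move: We ee; rewrite (_ : 4 * C2%:R * _ * _ = 2 * (2 * C2%:R * n.+1%:R ^+ 2 * y%:R ^+ n.+1)); last by ring.
move: (2 * C2%:R * n.+1%:R ^+ 2 * y%:R ^+ n.+1) => Z.
rewrite -[2 * Z / _]mulrA; set Zp := Z / _; set Tt := _ * (t ^+ n)^-1.
move=> h3 h4; have W0 : 0 <= W%:R :> R by [].
by apply/andP; split; lra.
Qed.

Lemma ln_prime_decomp (R : realType) (m X : nat) : (0 < m)%N -> (m <= X)%N ->
  ln m%:R = \sum_(0 <= p < X.+1 | prime p) (logn p m)%:R * ln p%:R :> R.
Proof.
move=> m0 mX; rewrite -[in LHS](partnT m0) (widen_partn _ mX) ln_prod_nat; last first.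
  by move=> p _; rewrite expn_gt0; case: p.
rewrite [RHS]big_mkcond; apply: eq_bigr => p _; case: ifP => [pp|pp].
  by rewrite natrX lnXn ?ltr0n ?prime_gt0 // mulr_natl.
by rewrite lognE pp /= expn0 ln1.
Qed.

(** The sum of the logarithms of all the norms over the box of side [y] is known to
be [y ^ n.+1 * (n.+1 * ln y + O(1))] from their sizes.  On the other hand it is
the sum over [p] of [ln p] times the total valuation at [p], which is close to
[y ^ n.+1] times the number of roots divided by [p]. *)
Lemma nagell_scale (R : realType) (n : nat) (f : {poly int}) :
  f \is monic -> size f = n.+2 ->
  irreducible_poly (map_poly intr f : {poly rat}) ->
  exists (P0 C1 : nat) (K : R), (0 < C1)%N /\ forall y, (0 < y)%N ->
  `|\sum_(0 <= p < (C1 * y ^ n.+1).+1 | prime p && (P0 < p)%N)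
     ln p%:R * ((nroots f p)%:R / p%:R) - n.+1%:R * ln y%:R| <= K.
Proof.
move=> fm sf firr.
have [q [P0 [C1 [C2 [[q0 C10 C20 dP pq] sizeb cnt equi]]]]] := nform_statistics fm sf firr.
have [t [t0 tE]] := nat_root R (ltn0Sn n).
have dR : 0 <= n.+1%:R :> R by [].
have q2 : (2 %| q)%N by rewrite pq //; lia.
pose A : R := C2%:R ^+ n.+1; pose B : R := 4 * C2%:R * n.+1%:R ^+ 2.
have A0 : 0 <= A by rewrite exprn_ge0.
have B0 : 0 <= B by rewrite mulr_ge0 ?exprn_ge0 // mulr_ge0.
have l40 : 0 <= ln 4%:R :> R by rewrite ln_ge0 // ler1n.
pose K1 : R := ln 4%:R * (A * (n.+1%:R * C1%:R)) + ln 4%:R * (B * 2).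
pose K2 : R := n.+1%:R * (1 + ln (4 * n.+1)%:R) + ln C1%:R.
have lC1 : 0 <= ln C1%:R :> R by rewrite ln_ge0 // ler1n.
have l4n : 0 <= ln (4 * n.+1)%:R :> R by rewrite ln_ge0 // ler1n muln_gt0.
exists P0, C1, (K1 + K2); split => // y y0.
have yR : 0 < y%:R :> R by rewrite ltr0n.
pose X := (C1 * y ^ n.+1)%N.
have nd (b : {ffun 'I_n.+1 -> 'I_y}) p : prime p -> (p <= P0)%N ->
    ~~ (p %| `|nform f (boxu q b)|)%N.
  move=> pp pP; have := @nform_coprime n f p q (boxv b) pp; rewrite !dvdzE /=.
  by apply; rewrite pq.
have N0 (b : {ffun 'I_n.+1 -> 'I_y}) : (0 < `|nform f (boxu q b)|)%N.
  have P2 : (2 <= P0)%N by lia.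
  by have := nd b 2%N isT P2; case: `|_|%N.
pose V p := (\sum_(b : {ffun 'I_n.+1 -> 'I_y}) logn p `|nform f (boxu q b)|)%N.
pose L : R := \sum_(b : {ffun 'I_n.+1 -> 'I_y}) ln (`|nform f (boxu q b)|%N)%:R.
have LE : L = \sum_(0 <= p < X.+1 | prime p && (P0 < p)%N) ln p%:R * (V p)%:R.
  rewrite /L (eq_bigr _ (fun b _ => ln_prime_decomp R (N0 b) (sizeb y b))) exchange_big /=.
  rewrite [RHS]big_mkcondr /=; apply: eq_bigr => p pp.
  rewrite -mulr_suml -natr_sum -/(V p) mulrC; case: ltnP => // pP.
  rewrite /V big1 ?mulr0 // => b _.
  by apply/eqP; rewrite -leqn0 leqNgt logn_gt0 mem_primes pp N0 /=; apply: nd.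
pose G : R := \sum_(0 <= p < X.+1 | prime p && (P0 < p)%N) ln p%:R * ((nroots f p)%:R / p%:R).
have VG : `|L - y%:R ^+ n.+1 * G| <= K1 * y%:R ^+ n.+1.
  rewrite LE /G mulr_sumr -sumrB; apply: le_trans (ler_norm_sum _ _ _) _.
  pose g i : R := A * y%:R ^+ n * (t i ^+ n)^-1 + B * y%:R ^+ n.+1 * (i%:R ^+ 2)^-1.
  apply: (@le_trans _ _ (\sum_(0 <= p < X.+1 | prime p) ln p%:R * g p)).
    rewrite big_mkcondr /= big_nat_cond [leRHS]big_nat_cond; apply: ler_sum => p /andP[/andP[_ pX] pp].
    have lp : 0 <= ln p%:R :> R by rewrite ln_ge0 // ler1n prime_gt0.
    case: ltnP => [Pp|_]; last first.
      by rewrite mulr_ge0 // /g addr_ge0 // !mulr_ge0 ?invr_ge0 ?exprn_ge0.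
    rewrite mulrCA -mulrBr normrM (ger0_norm lp); apply: ler_wpM2l => //.
    apply: (valuation_sum_near pp fm sf y0 dP Pp (t0 p) (tE p) N0 (sizeb y) _
      (equi y p pp Pp pX)) => j j0.
    exact: cnt.
  have ti i : (0 < i)%N -> 0 < t i.
    move=> i0; rewrite lt_neqAle t0 andbT eq_sym; apply/eqP => ti0.
    by have := tE i; rewrite ti0 expr0n /= => /esym/eqP; rewrite pnatr_eq0 gtn_eqF.
  have tmon i j : (i <= j)%N -> t i <= t j.
    by move=> ij; rewrite -(@ler_pXn2r _ n.+1) ?nnegrE // !tE ler_nat.
  apply: le_trans (prime_sum_le _ _ _) _.
  - move=> i i0; apply: lerD; apply: ler_wpM2l; rewrite ?mulr_ge0 ?exprn_ge0 //.
      by rewrite lef_pV2 ?posrE ?exprn_gt0 ?ti // lerXn2r ?nnegrE ?tmon.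
    by rewrite lef_pV2 ?posrE ?exprn_gt0 ?ltr0n // lerXn2r ?nnegrE // ler_nat.
  - by move=> i i0; rewrite addr_ge0 // !mulr_ge0 ?invr_ge0 ?exprn_ge0.
  rewrite /K1 -mulrDr -mulrA; apply: ler_wpM2l => //.
  rewrite big_split /= -!mulr_sumr mulrDl; apply: lerD; last first.
    rewrite -mulrA [in leRHS]mulrAC -mulrA; apply: ler_wpM2l => //.
    apply: ler_wpM2l; first exact: exprn_ge0.
    by apply: le_trans (sum_inv_sqr_le R X.+1 (ltn0Sn 0)) _; rewrite divr1.
  have tX : t X <= C1%:R * y%:R.
    rewrite -(@ler_pXn2r _ n.+1) ?nnegrE ?mulr_ge0 // tE exprMn /X natrM natrX.
    apply: ler_wpM2r; first exact: exprn_ge0.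
    by rewrite -natrX ler_nat -{1}[C1]expn1 leq_pexp2l.
  rewrite -!mulrA; apply: ler_wpM2l => //.
  rewrite exprS mulrA mulrA [leRHS]mulrC; apply: ler_wpM2l; first exact: exprn_ge0.
  apply: le_trans (sum_inv_root_le X t0 tE) _.
  by rewrite -mulrA; apply: ler_wpM2l.
have Lge := sum_ln_nform_ge R n y f q2 q0; have Lle := sum_ln_nform_le R C10 y0 N0 (sizeb y).
rewrite -/L in Lge Lle; rewrite -/X -/G.
have yd : 0 < y%:R ^+ n.+1 :> R by rewrite exprn_gt0.
rewrite -(ler_pM2l yd) -[X in X * `|_|](gtr0_norm yd) -normrM.
move: VG Lge Lle yd; rewrite !ler_norml => /andP[v1 v2].
rewrite /K2; move: (y%:R ^+ n.+1) v1 v2 => Y v1 v2 l1 l2 Y0.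
have c1 : 0 <= Y * ln C1%:R by rewrite mulr_ge0 // ltW.
have c2 : 0 <= Y * (n.+1%:R * (1 + ln (4 * n.+1)%:R)) by rewrite !mulr_ge0 // ?ltW // ltr_wpDr.
by apply/andP; split; lra.
Qed.

Lemma sum_primes_near (R : realType) (m : nat) (u v : nat -> R) :
  (forall p, prime p -> (m < p)%N -> u p = v p) ->
  forall N, `|\sum_(0 <= p < N | prime p) u p - \sum_(0 <= p < N | prime p) v p| <=
    \sum_(0 <= p < m.+1 | prime p) `|u p - v p|.
Proof.
move=> uv N; rewrite -sumrB; apply: le_trans (ler_norm_sum _ _ _) _.
have [Nm|mN] := leqP N m.+1.
  by rewrite [leRHS](big_cat_nat (n := N)) //= lerDl sumr_ge0.
rewrite (big_cat_nat (n := m.+1)) //=; last exact: ltnW.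
rewrite gerDl big_nat_cond big1 // => p /andP[/andP[mp _] pp].
by rewrite uv // subrr normr0.
Qed.

Lemma ln_natM (R : realType) (a b : nat) : (0 < a)%N -> (0 < b)%N ->
  ln (a * b)%:R = ln a%:R + ln b%:R :> R.
Proof. by move=> a0 b0; rewrite natrM lnM // posrE ltr0n. Qed.

Lemma ln_natX (R : realType) (a d : nat) : (0 < a)%N ->
  ln (a ^ d)%:R = d%:R * ln a%:R :> R.
Proof. by move=> a0; rewrite natrX lnXn ?ltr0n // mulr_natl. Qed.

Lemma ler_ln_nat (R : realType) (a b : nat) : (0 < a)%N -> (a <= b)%N ->
  ln a%:R <= ln b%:R :> R.
Proof.
by move=> a0 ab; rewrite ler_ln ?posrE ?ltr0n ?(leq_trans a0 ab) // ler_nat.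
Qed.

(** Interpolation between the scales [C1 * y ^ n.+1], where the sum is known. *)
Lemma nagell_monic (R : realType) (n : nat) (f : {poly int}) :
  f \is monic -> size f = n.+2 ->
  irreducible_poly (map_poly intr f : {poly rat}) ->
  exists K : R, forall N, (0 < N)%N ->
  `|\sum_(0 <= p < N.+1 | prime p) ln p%:R * ((nroots f p)%:R / p%:R) - ln N%:R| <= K.
Proof.
move=> fm sf firr; have [P0 [C1 [K [C10 HK]]]] := nagell_scale R fm sf firr.
pose u p : R := ln p%:R * ((nroots f p)%:R / p%:R).
pose u' p : R := if (P0 < p)%N then u p else 0.
have u0 p : prime p -> 0 <= u p.
  by move=> pp; rewrite mulr_ge0 ?divr_ge0 // ln_ge0 // ler1n prime_gt0.
pose T N : R := \sum_(0 <= p < N.+1 | prime p) u' p.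
have Tmon M N : (M <= N)%N -> T M <= T N.
  move=> MN; rewrite /T (big_cat_nat (n := M.+1) (p := N.+1)) //= lerDl.
  by rewrite sumr_ge0 // => p pp; rewrite /u'; case: ifP => // _; apply: u0.
have T0 N : 0 <= T N.
  by apply: sumr_ge0 => p pp; rewrite /u'; case: ifP => // _; apply: u0.
have TK y : (0 < y)%N -> `|T (C1 * y ^ n.+1)%N - n.+1%:R * ln y%:R| <= K.
  by move=> /HK; rewrite big_mkcondr.
have K0 : 0 <= K by apply: le_trans (TK 1%N isT).
set E0 := \sum_(0 <= p < P0.+1 | prime p) `|u p - u' p|.
have l2 : 0 <= ln 2%:R :> R by rewrite ln_ge0 // ler1n.
have l4C : 0 <= ln (4 * C1)%:R :> R by rewrite ln_ge0 // ler1n muln_gt0.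
exists (E0 + (K + n.+1%:R * (ln 2%:R + ln (4 * C1)%:R))) => N Npos.
have TN : `|\sum_(0 <= p < N.+1 | prime p) u p - T N| <= E0.
  by apply: sum_primes_near => p pp Pp; rewrite /u' Pp.
suff TlnN : `|T N - ln N%:R| <= K + n.+1%:R * (ln 2%:R + ln (4 * C1)%:R).
  have -> : \sum_(0 <= p < N.+1 | prime p) u p - ln N%:R =
    (\sum_(0 <= p < N.+1 | prime p) u p - T N) + (T N - ln N%:R) by ring.
  by apply: le_trans (ler_normD _ _) _; apply: lerD.
have [y [yN Ny]] := exists_iroot N (ltn0Sn n).
have y0 : (0 < y)%N by rewrite lt0n; apply: contraTneq Ny => ->; rewrite exp1n -leqNgt.
have up : T N <= K + n.+1%:R * ln 2%:R + ln N%:R.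
  apply: (@le_trans _ _ (T (C1 * y.+1 ^ n.+1)%N)).
    by apply: Tmon; apply: leq_trans (ltnW Ny) _; rewrite leq_pmull.
  have := TK y.+1 isT; rewrite ler_norml => /andP[_].
  have : n.+1%:R * ln (y.+1)%:R <= n.+1%:R * ln 2%:R + ln N%:R :> R.
    rewrite -ln_natX // -ln_natX // -ln_natM ?expn_gt0 //; apply: ler_ln_nat; rewrite ?expn_gt0 //.
    apply: leq_trans (leq_mul (leqnn _) yN); rewrite -expnMn leq_exp2r //; lia.
  by lra.
have dR : 0 <= n.+1%:R :> R by [].
have lo : ln N%:R <= T N + K + n.+1%:R * ln (4 * C1)%:R.
  (* [C1 * (y %/ C1) ^ n.+1 <= y ^ n.+1 <= N], as [C1 <= C1 ^ n.+1]. *)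
  have [z0|zpos] := posnP (y %/ C1).
    have yC : (y < C1)%N by rewrite ltnNge; apply/negP => Cy; have := divn_gt0 y C10; rewrite z0 Cy.
    apply: (@le_trans _ _ (n.+1%:R * ln (4 * C1)%:R)).
      rewrite -ln_natX ?muln_gt0 //; apply: ler_ln_nat => //; apply: leq_trans (ltnW Ny) _.
      by rewrite leq_exp2r //; lia.
    by have := T0 N; lra.
  have := TK _ zpos; rewrite ler_norml => /andP[h _].
  have TT : T (C1 * (y %/ C1) ^ n.+1)%N <= T N.
    apply: Tmon; apply: leq_trans yN; apply: leq_trans (_ : (C1 * (y %/ C1)) ^ n.+1 <= _)%N.
      by rewrite expnMn leq_mul2r; apply/orP; right; rewrite -{1}[C1]expn1 leq_pexp2l.
    by rewrite leq_exp2r // mulnC leq_divM.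
  have : ln N%:R <= n.+1%:R * ln (4 * C1)%:R + n.+1%:R * ln (y %/ C1)%:R :> R.
    rewrite -ln_natX ?muln_gt0 // -ln_natX // -ln_natM ?expn_gt0 ?zpos ?muln_gt0 ?C10 //.
    apply: ler_ln_nat => //; apply: leq_trans (ltnW Ny) _; rewrite -expnMn leq_exp2r //.
    have := divn_eq y C1; have := ltn_pmod y C10; move: zpos.
    by move: (y %/ C1)%N (y %% C1)%N => z r; nia.
  by lra.
have c1 : 0 <= n.+1%:R * ln 2%:R :> R by rewrite mulr_ge0.
have c2 : 0 <= n.+1%:R * ln (4 * C1)%:R :> R by rewrite mulr_ge0.
by rewrite ler_norml mulrDr; apply/andP; split; lra.
Qed.

(** With [c] the leading coefficient of [f], of degree [n.+1], the monic
polynomial [c ^ n * f (X / c)]. *)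
Definition monicize (n : nat) (f : {poly int}) : {poly int} :=
  \poly_(i < n.+2) (if i == n.+1 then 1 else f`_i * lead_coef f ^+ (n - i)).

Lemma size_monicize (n : nat) (f : {poly int}) : size (monicize n f) = n.+2.
Proof. by rewrite size_poly_eq // eqxx oner_eq0. Qed.

Lemma monicize_monic (n : nat) (f : {poly int}) : monicize n f \is monic.
Proof.
by apply/monicP; rewrite lead_coefE size_monicize /= coef_poly ltnSn eqxx.
Qed.

Lemma monicize_horner (n : nat) (f : {poly int}) (r : int) : size f = n.+2 ->
  (monicize n f).[lead_coef f * r] = lead_coef f ^+ n * f.[r].
Proof.
move=> sf; rewrite (horner_coef_wide _ (size_poly _ _)) horner_coef sf mulr_sumr.
apply: eq_bigr => i _; rewrite coef_poly ltn_ord exprMn.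
have [->|i1] := eqVneq (i : nat) n.+1.
  by rewrite mul1r mulrA -[f`_n.+1]/(f`_(n.+2.-1)) -sf -lead_coefE exprSr.
have -> : lead_coef f ^+ n = lead_coef f ^+ (n - i) * lead_coef f ^+ i.
  by rewrite -exprD subnK //; have := ltn_ord i; lia.
by ring.
Qed.

Lemma monicize_comp (n : nat) (f : {poly int}) : size f = n.+2 ->
  monicize n f \Po (lead_coef f *: 'X) = lead_coef f ^+ n *: f.
Proof.
move=> sf; rewrite comp_polyE size_monicize -[X in _ = _ *: X]coefK sf poly_def scaler_sumr.
apply: eq_bigr => i _; rewrite coef_poly ltn_ord exprZn !scalerA; congr (_ *: _).
have [->|i1] := eqVneq (i : nat) n.+1.
  by rewrite mul1r -[f`_n.+1]/(f`_(n.+2.-1)) -sf -lead_coefE exprSr.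
have -> : lead_coef f ^+ n = lead_coef f ^+ (n - i) * lead_coef f ^+ i.
  by rewrite -exprD subnK //; have := ltn_ord i; lia.
by ring.
Qed.

Lemma monicize_irreducible (n : nat) (f : {poly int}) : size f = n.+2 ->
  irreducible_poly (map_poly intr f : {poly rat}) ->
  irreducible_poly (map_poly intr (monicize n f) : {poly rat}).
Proof.
move=> sf [_ firr]; set g : {poly rat} := map_poly intr (monicize n f).
have injQ := @intr_inj rat.
have sg : size g = n.+2 by rewrite size_map_inj_poly ?size_monicize.
have c0 : (lead_coef f)%:~R != 0 :> rat.
  by rewrite intr_eq0 lead_coef_eq0 -size_poly_eq0 sf.
pose cX : {poly rat} := (lead_coef f)%:~R *: 'X.
have scX : size cX = 2 by rewrite size_scale // size_polyX.
have gE : g \Po cX = (lead_coef f)%:~R ^+ n *: map_poly intr f.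
  have := congr1 (map_poly (intr : int -> rat)) (monicize_comp sf).
  rewrite map_comp_poly !map_polyZ /= map_polyX rmorphXn. by [].
split; first by rewrite sg.
move=> h sh hg.
have hf : h \Po cX %= map_poly intr f.
  apply: firr; first by rewrite size_comp_poly2.
  have : h \Po cX %| g \Po cX by apply: dvdp_comp_poly.
  by rewrite gE dvdpZr // expf_neq0.
rewrite -(dvdp_size_eqp hg) sg.
by have := eqp_size hf; rewrite size_comp_poly2 // => ->; rewrite size_map_inj_poly // sf.
Qed.

Lemma nroots_monicize (n p : nat) (f : {poly int}) : size f = n.+2 ->
  prime p -> ~~ (p %| lead_coef f)%Z -> nroots (monicize n f) p = nroots f p.
Proof.
move=> sf pp pc; rewrite /nroots.
have p0 : p%:Z != 0 by rewrite eqz_nat -lt0n prime_gt0.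
have hp (r : 'I_p) : (`|modz (lead_coef f * r%:Z) p| < p)%N.
  have := modz_ge0 (lead_coef f * r%:Z) p0; have := ltz_mod (lead_coef f * r%:Z) p0.
  by lia.
pose h r := Ordinal (hp r).
have hE r : (h r)%:Z%:~R = (lead_coef f)%:~R * r%:Z%:~R :> 'F_p.
  rewrite /h /= abszE ger0_norm ?modz_ge0 // -intrM; apply/eqP.
  rewrite -subr_eq0 -intrB Fp_intr_eq0 // -eqz_mod_dvd; apply/eqP.
  by rewrite modz_mod.
have c0 : (lead_coef f)%:~R != 0 :> 'F_p by rewrite Fp_intr_eq0.
have hinj : injective h.
  move=> r r' rr'; have := hE r; rewrite rr' hE => /(mulfI c0)/esym.
  exact: Fp_ord_inj.
rewrite -!sum1_card (reindex_inj hinj) /=; apply: eq_bigl => r.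
rewrite !inE -!Fp_intr_eq0 // -Fp_horner hE -intrM Fp_horner monicize_horner // intrM.
rewrite mulf_eq0; have -> : (lead_coef f ^+ n)%:~R == 0 :> 'F_p = false.
  by rewrite rmorphXn /= expf_eq0 (negbTE c0) andbF.
by [].
Qed.

(** The scaling that makes [f] monic permutes the residues modulo the primes that
do not divide its leading coefficient, so the monic case suffices. *)
Theorem nagell (R : realType) (f : {poly int}) :
  irreducible_poly (map_poly intr f : {poly rat}) ->
  exists K : R, forall N, (0 < N)%N ->
  `|\sum_(0 <= p < N.+1 | prime p) ln p%:R * ((nroots f p)%:R / p%:R) - ln N%:R| <= K.
Proof.
move=> firr; have [sf1 _] := firr; rewrite size_map_inj_poly // in sf1; last exact: intr_inj.
have [n sf] : exists n, size f = n.+2 by exists (size f).-2; case: (size f) sf1 => [|[]].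
have [K HK] := nagell_monic R (monicize_monic n f) (size_monicize n f) (monicize_irreducible sf firr).
pose u p : R := ln p%:R * ((nroots f p)%:R / p%:R).
pose v p : R := ln p%:R * ((nroots (monicize n f) p)%:R / p%:R).
exists (\sum_(0 <= p < `|lead_coef f|.+1 | prime p) `|u p - v p| + K) => N N0.
have c0 : lead_coef f != 0 by rewrite lead_coef_eq0 -size_poly_eq0 sf.
have uv : `|\sum_(0 <= p < N.+1 | prime p) u p - \sum_(0 <= p < N.+1 | prime p) v p| <=
    \sum_(0 <= p < `|lead_coef f|.+1 | prime p) `|u p - v p|.
  apply: sum_primes_near => p pp cp; rewrite /u /v (nroots_monicize sf pp) //.
  rewrite dvdzE /=; apply/negP => /dvdn_leq; rewrite absz_gt0 => /(_ c0).
  by rewrite leqNgt cp.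
have := HK N N0; rewrite -/(v _) => HKN.
have -> : \sum_(0 <= p < N.+1 | prime p) u p - ln N%:R =
   (\sum_(0 <= p < N.+1 | prime p) u p - \sum_(0 <= p < N.+1 | prime p) v p) +
   (\sum_(0 <= p < N.+1 | prime p) v p - ln N%:R) by ring.
by apply: le_trans (ler_normD _ _) _; apply: lerD.
Qed.

(** * The roots of a system modulo a prime *)

(** A common factor of two members would give the product a multiple root, hence
too few distinct roots. *)
Lemma system_coprime (k : nat) (F : 'I_k -> {poly int})
  (F_deg : forall i, (1 <= (size (F i)).-1)%N)
  (F_roots : [set z : algC | root (map_poly intr (\prod_(i < k) F i)) z]
     #= `I_(\sum_(i < k) (size (F i)).-1)) (i j : 'I_k) :
  i != j -> coprimep (map_poly intr (F i) : {poly rat}) (map_poly intr (F j)).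
Proof.
move=> ij; pose P := \prod_(i < k) F i; pose PC : {poly algC} := map_poly intr P.
have F0 l : F l != 0 by have := F_deg l; rewrite -size_poly_eq0; case: (size _).
set D := (\sum_(i < k) _)%N in F_roots.
have injC := @intr_inj algC.
have sP : size P = D.+1.
  rewrite size_prod // card_ord.
  have -> : (\sum_(l < k) size (F l) = D + k)%N.
    rewrite -[X in (_ + X)%N]card_ord -sum1_card -big_split /=; apply: eq_bigr => l _.
    by have := F_deg l; case: (size (F l)) => //= u _; rewrite addn1.
  by rewrite -addSn addnK.
have sPC : size PC = D.+1 by rewrite size_map_inj_poly.
have PC0 : PC != 0 by rewrite -size_poly_eq0 sPC.
have [rs PCE] := closed_field_poly_normal PC.
have lc0 : lead_coef PC != 0 by rewrite lead_coef_eq0.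
have srs : size rs = D.
  have : size PC = D.+1 by [].
  by rewrite PCE size_scale // size_prod_XsubC => -[].
have rootP z : root PC z = (z \in rs).
  by rewrite PCE rootZ // root_prod_XsubC.
have urs : uniq rs.
  move: F_roots; rewrite card_eq_sym => eqD.
  have f := unsquash (elimT ocard_eqP eqD).
  have fI l : (l < D)%N -> f l \in [seq Some z | z <- rs].
    move=> lD; have [z /= zr <-] := @funS _ _ _ _ f l lD.
    by rewrite map_f // -rootP.
  have funiq : uniq [seq f l | l <- iota 0 D].
    rewrite map_inj_in_uniq ?iota_uniq // => l l'; rewrite !mem_iota !add0n /= => lD l'D.
    by apply: (@inj _ _ _ f); rewrite inE.
  rewrite -(map_inj_uniq (@Some_inj _)); apply: (leq_size_uniq funiq) => [z /mapP[l]|].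
    by rewrite mem_iota add0n => /andP[_ lD] ->; apply: fI.
  by rewrite !size_map size_iota srs.
have sep : separable_poly PC.
  by rewrite PCE (eqp_separable (eqp_scale _ lc0)) separable_prod_XsubC.
have mapFE l : map_poly intr (F l) = map_poly ratr (map_poly intr (F l) : {poly rat}) :> {poly algC}.
  by rewrite -map_poly_comp; apply: eq_map_poly => z /=; rewrite ratr_int.
have : coprimep (map_poly (intr : int -> algC) (F i)) (map_poly intr (F j)).
  apply: (separable_coprime sep).
  rewrite /PC /P (bigD1 i) //= (bigD1 j) /= 1?eq_sym // mulrA !rmorphM /=.
  exact: dvdp_mulIl.
by rewrite !mapFE coprimep_map.
Qed.

(** Two coprime members have a common root only modulo the divisors of the constant
of a Bezout identity. *)
Lemma nu_sum_nroots (k : nat) (F : 'I_k -> {poly int}) :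
  (forall i j, i != j -> coprimep (map_poly intr (F i) : {poly rat}) (map_poly intr (F j))) ->
  exists m, forall p, prime p -> (m < p)%N -> nu F p = (\sum_(i < k) nroots (F i) p)%N.
Proof.
move=> cop.
have exm (u : 'I_k * 'I_k) : exists m : nat, u.1 != u.2 -> forall p r, prime p -> (m < p)%N ->
    (p %| (F u.1).[r])%Z -> (p %| (F u.2).[r])%Z -> false.
  case: u => i j /=; have [->|ij] := eqVneq i j; first by exists 0%N.
  have [u [v [m [m0 uv]]]] := int_Bezout (cop _ _ ij).
  exists `|m|%N => _ p r pp mp pi pj.
  have := congr1 (horner^~ r) uv; rewrite hornerD !hornerM hornerC => E.
  have : (p %| m)%Z by rewrite -E; apply: rpredD; apply: dvdz_mull.
  by rewrite dvdzE /= => /dvdn_leq; rewrite absz_gt0 => /(_ m0); rewrite leqNgt mp.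
have {exm} [mm mmP] := choice exm.
exists (\max_u mm u)%N => p pp mp.
have disj i j r : (p %| (F i).[r])%Z -> (p %| (F j).[r])%Z -> i = j.
  move=> pi pj; apply/eqP; apply: contraT => ij.
  by apply: (mmP (i, j) ij p r pp) => //; apply: leq_ltn_trans mp; apply: leq_bigmax.
rewrite /nu -sum1_card.
under [RHS]eq_bigr => i _ do rewrite /nroots -sum1_card big_mkcond /=.
rewrite exchange_big /= big_mkcond /=; apply: eq_bigr => r _; rewrite inE.
have dvdP : (p%:Z %| \prod_(i < k) (F i).[r%:Z])%Z = [exists i, (p%:Z %| (F i).[r%:Z])%Z].
  apply/idP/existsP => [|[i pi]]; last by rewrite (bigD1 i) //= dvdz_mulr.
  elim/big_ind: _ => [|x y Hx Hy|i _ pi]; last by exists i.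
    by rewrite dvdzE /= dvdn1 => /eqP p1; rewrite p1 in pp.
  by rewrite dvdzE abszM /= Euclid_dvdM // => /orP[]; [move/Hx|move/Hy].
rewrite dvdP; case: existsP => [[i pi]|np].
  rewrite (bigD1 i) //= inE pi big1 // => j ji; rewrite inE.
  by case: ifP => // pj; rewrite (disj _ _ _ pj pi) eqxx in ji.
by rewrite big1 // => i _; rewrite inE; case: ifP => // pi; case: np; exists i.
Qed.

Lemma nroots_bounded (f : {poly int}) : (1 < size f)%N ->
  exists m, forall p, prime p -> (m < p)%N -> (nroots f p <= size f)%N.
Proof.
move=> sf1; have [n sf] : exists n, size f = n.+2 by exists (size f).-2; case: (size f) sf1 => [|[]].
exists `|lead_coef f|%N => p pp mp; rewrite -(nroots_monicize sf pp).
  apply: leq_trans (nroots_le pp (monicize_monic n f) (size_monicize n f)) _.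
  by rewrite sf.
have c0 : lead_coef f != 0 by rewrite lead_coef_eq0 -size_poly_eq0 sf.
rewrite dvdzE /=; apply/negP => /dvdn_leq; rewrite absz_gt0 => /(_ c0).
by rewrite leqNgt mp.
Qed.

Lemma finite_max (k : nat) (Q : 'I_k -> nat -> Prop) :
  (forall i, exists m, forall p, prime p -> (m < p)%N -> Q i p) ->
  exists m, forall p, prime p -> (m < p)%N -> forall i, Q i p.
Proof.
move=> /choice[m mP]; exists (\max_i m i)%N => p pp mp i; apply: mP => //.
by apply: leq_ltn_trans mp; apply: leq_bigmax.
Qed.

(** Mertens' first theorem is the case of the polynomial [X]. *)
Lemma mertens (R : realType) : exists K : R, forall N, (0 < N)%N ->
  `|\sum_(0 <= p < N.+1 | prime p) ln p%:R * (1 / p%:R) - ln N%:R| <= K.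
Proof.
have Xirr : irreducible_poly (map_poly intr 'X : {poly rat}).
  by rewrite map_polyX -['X]subr0 -[0]/(0%:P) ; apply: irredp_XsubC.
have [K HK] := nagell R Xirr; exists K => N N0.
rewrite (eq_bigr (fun p => ln p%:R * ((nroots 'X p)%:R / p%:R))); first exact: HK.
move=> p pp; congr (_ * (_ / _)); suff -> : nroots 'X p = 1%N by [].
have p0 := prime_gt0 pp.
rewrite /nroots -(card1 (Ordinal p0)); apply: eq_card => r.
rewrite !inE hornerX dvdzE /=; apply/idP/eqP => [pr|->]; last exact: dvdn0.
by apply: val_inj => /=; rewrite -[LHS](modn_small (ltn_ord r)); apply/eqP.
Qed.

(** Each of the [k] members contributes one root on average, by [nagell]. *)
Lemma nu_mean (R : realType) (k : nat) (F : 'I_k -> {poly int}) :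
  (forall i, irreducible_poly (map_poly intr (F i) : {poly rat})) ->
  (forall i j, i != j -> coprimep (map_poly intr (F i) : {poly rat}) (map_poly intr (F j))) ->
  exists K : R, forall N,
  `|\sum_(0 <= p < N | prime p) ln p%:R * (((nu F p)%:R - k%:R) / p%:R)| <= K.
Proof.
move=> firr cop; have [m nuE] := nu_sum_nroots cop.
have [KM HM] := mertens R.
have /choice[Kf Hf] : forall i, exists K : R, forall N, (0 < N)%N ->
    `|\sum_(0 <= p < N.+1 | prime p) ln p%:R * ((nroots (F i) p)%:R / p%:R) - ln N%:R| <= K.
  by move=> i; apply: nagell.
pose u p : R := ln p%:R * (((nu F p)%:R - k%:R) / p%:R).
pose v p : R := ln p%:R * (((\sum_(i < k) nroots (F i) p)%N%:R - k%:R) / p%:R).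
set E := \sum_(0 <= p < m.+1 | prime p) `|u p - v p|.
have E0 : 0 <= E by apply: sumr_ge0.
pose Kv : R := \sum_(i < k) Kf i + k%:R * KM.
have KM0 : 0 <= KM by apply: le_trans (HM 1%N isT).
have Kv0 : 0 <= Kv.
  apply: addr_ge0; last by rewrite mulr_ge0.
  by apply: sumr_ge0 => i _; apply: le_trans (Hf i 1%N isT); apply: normr_ge0.
exists (E + Kv) => N.
have [N1|N1] := leqP N 1.
  rewrite big_nat_cond big1 ?normr0; first exact: (addr_ge0 E0 Kv0).
  move=> p /andP[/andP[_ pN] pp].
  by have := prime_gt1 pp; lia.
have -> : N = (N.-1).+1 by lia.
have {N1} : (0 < N.-1)%N by lia.
move: N.-1 => {}N N0.
have uv : `|\sum_(0 <= p < N.+1 | prime p) u p - \sum_(0 <= p < N.+1 | prime p) v p| <= E.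
  by apply: sum_primes_near => p pp mp; rewrite /u /v nuE.
have vE : \sum_(0 <= p < N.+1 | prime p) v p =
   \sum_(i < k) (\sum_(0 <= p < N.+1 | prime p) ln p%:R * ((nroots (F i) p)%:R / p%:R) - ln N%:R)
   - k%:R * (\sum_(0 <= p < N.+1 | prime p) ln p%:R * (1 / p%:R) - ln N%:R).
  have E3 (a b c : R) : a - b - (c - b) = a - c by ring.
  rewrite sumrB sumr_const card_ord -[ln N%:R *+ k]mulr_natl mulrBr E3.
  rewrite exchange_big /= mulr_sumr -sumrB; apply: eq_bigr => p pp.
  rewrite -mulr_sumr -mulr_suml -natr_sum /v; ring.
have vb : `|\sum_(0 <= p < N.+1 | prime p) v p| <= Kv.
  rewrite vE; apply: le_trans (ler_normB _ _) _; apply: lerD.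
    by apply: le_trans (ler_norm_sum _ _ _) _; apply: ler_sum => i _; apply: Hf.
  by rewrite normrM ger0_norm //; apply: ler_wpM2l => //; apply: HM.
have -> : \sum_(0 <= p < N.+1 | prime p) ln p%:R * (((nu F p)%:R - k%:R) / p%:R) =
  (\sum_(0 <= p < N.+1 | prime p) u p - \sum_(0 <= p < N.+1 | prime p) v p) +
  \sum_(0 <= p < N.+1 | prime p) v p by rewrite subrK.
by apply: le_trans (ler_normD _ _) _; apply: lerD.
Qed.

(** * The tail of the singular product *)

Lemma ln1B_near (R : realType) (x : R) : 0 <= x -> x <= 2^-1 ->
  `|ln (1 - x) + x| <= 2 * x ^+ 2.
Proof.
move=> x0 x2; have x1 : 0 < 1 - x by lra.
have up : ln (1 - x) <= - x by apply: le_trans (ln_le_subr1 x1) _; lra.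
have lo : - ln (1 - x) <= x / (1 - x).
  rewrite -lnV ?posrE //; apply: le_trans (ln_le_subr1 _) _; rewrite ?invr_gt0 //.
  rewrite le_eqVlt; apply/orP; left; apply/eqP; field; by rewrite gt_eqF.
have : x / (1 - x) <= x + 2 * x ^+ 2.
  by rewrite ler_pdivrMr // expr2; nra.
have x20 : 0 <= 2 * x ^+ 2 by rewrite mulr_ge0 // exprn_ge0.
by move=> h; rewrite ler_norml; apply/andP; split; lra.
Qed.

Lemma ln_local_factor_near (R : realType) (k B p : nat) (F : 'I_k -> {poly int}) :
  prime p -> (nu F p <= B)%N -> (2 * B <= p)%N ->
  0 < local_factor R F p /\
  `|ln (local_factor R F p) + ((nu F p)%:R - k%:R) / p%:R| <=
    (2 * (B%:R ^+ 2 + k%:R)) * (p%:R ^+ 2)^-1.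
Proof.
move=> pp nB Bp; have p0 : 0 < p%:R :> R by rewrite ltr0n prime_gt0.
pose x : R := (nu F p)%:R / p%:R; pose z : R := p%:R^-1.
have half a : (2 * a <= p)%N -> a%:R / p%:R <= 2^-1 :> R.
  by move=> ap; rewrite ler_pdivrMr // mulrC ler_pdivlMr // -natrM ler_nat mulnC.
have x0 : 0 <= x by rewrite divr_ge0.
have x2 : x <= 2^-1 by apply: half; apply: leq_trans Bp; rewrite leq_mul2l.
have z0 : 0 <= z by rewrite invr_ge0.
have z2 : z <= 2^-1.
  by have := half 1%N (prime_gt1 pp); rewrite mul1r.
have x1 : 0 < 1 - x by lra.
have z1 : 0 < 1 - z by lra.
split; first by rewrite /local_factor divr_gt0 // exprn_gt0.
have -> : ln (local_factor R F p) = ln (1 - x) - k%:R * ln (1 - z).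
  by rewrite /local_factor -/x -/z ln_div ?posrE ?exprn_gt0 // lnXn // mulr_natl.
have -> : ln (1 - x) - k%:R * ln (1 - z) + ((nu F p)%:R - k%:R) / p%:R =
   (ln (1 - x) + x) - k%:R * (ln (1 - z) + z).
  by rewrite mulrBl /x /z; ring.
apply: le_trans (ler_normB _ _) _.
rewrite normrM (@ger0_norm _ k%:R) //.
have h1 := ln1B_near x0 x2; have h2 := ler_wpM2l (ler0n R k) (ln1B_near z0 z2).
have xB : x ^+ 2 <= B%:R ^+ 2 * z ^+ 2.
  by rewrite -exprMn lerXn2r ?nnegrE ?mulr_ge0 // ler_wpM2r // ler_nat.
rewrite -exprVn -/z.
have -> : 2 * (B%:R ^+ 2 + k%:R) * z ^+ 2 = 2 * (B%:R ^+ 2 * z ^+ 2) + k%:R * (2 * z ^+ 2) by ring.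
by lra.
Qed.

(** The logarithm of a local factor is [(k - nu p) / p] up to [O(1 / p ^ 2)].
Summation by parts against the weights [1 / ln p] turns the bounded sums of
[nu_mean] into the bound for the main terms. *)
Lemma local_factor_tail (R : realType) (k : nat) (F : 'I_k -> {poly int})
  (F_deg : forall i, (1 <= (size (F i)).-1)%N)
  (F_irr : forall i, irreducible_poly (map_poly intr (F i) : {poly rat}))
  (F_cop : forall i j, i != j ->
    coprimep (map_poly intr (F i) : {poly rat}) (map_poly intr (F j))) :
  exists (m0 : nat) (C : R), [/\ (2 <= m0)%N, 0 < C,
    forall p, prime p -> (m0 <= p)%N -> 0 < local_factor R F p &
    forall m N, (m0 <= m)%N ->
      `|\sum_(m <= p < N | prime p) ln (local_factor R F p)| <= C / ln m%:R].
Proof.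
have [K HK] := nu_mean R F_irr F_cop.
have [m1 nuE] := nu_sum_nroots F_cop.
have [m2 nrB] : exists m, forall p, prime p -> (m < p)%N -> forall i, (nroots (F i) p <= size (F i))%N.
  apply: (@finite_max _ (fun i p => (nroots (F i) p <= size (F i))%N)) => i.
  by apply: nroots_bounded; have := F_deg i; case: (size _) => [|[]].
pose B := (\sum_(i < k) size (F i))%N.
pose m0 := (m1 + m2 + 2 * B + 2)%N.
pose D : R := 2 * (B%:R ^+ 2 + k%:R).
have D0 : 0 <= D by rewrite mulr_ge0 // addr_ge0 // exprn_ge0.
have K0 : 0 <= K by apply: le_trans (HK 0%N).
have near p : prime p -> (m0 <= p)%N -> 0 < local_factor R F p /\
    `|ln (local_factor R F p) + ((nu F p)%:R - k%:R) / p%:R| <= D * (p%:R ^+ 2)^-1.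
  move=> pp mp; rewrite /m0 in mp; apply: ln_local_factor_near => //; last by lia.
  rewrite nuE //; last by lia.
  by apply: leq_sum => i _; apply: nrB => //; lia.
exists m0, (2 * K + 2 * D + 1); split.
- by rewrite /m0; lia.
- by lra.
- by move=> p pp /(near p pp)[].
move=> m N m0m; have m2' : (2 <= m)%N by rewrite /m0 in m0m; lia.
have m1' : (1 < m)%N by [].
have lm : 0 < ln m%:R :> R by rewrite ln_gt0 // ltr1n.
have [Nm|mN] := leqP N m.
  rewrite big_geq // normr0 divr_ge0 // ?ltW //; lra.
pose g p : R := ((nu F p)%:R - k%:R) / p%:R.
pose a p : R := if prime p then ln p%:R * g p else 0.
pose w p : R := (ln p%:R)^-1.
have aK j : (m <= j)%N -> `|\sum_(m <= p < j) a p| <= 2 * K.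
  move=> mj.
  have -> : \sum_(m <= p < j) a p =
     \sum_(0 <= p < j | prime p) ln p%:R * g p - \sum_(0 <= p < m | prime p) ln p%:R * g p.
    rewrite [X in _ = X - _](big_cat_nat (n := m) (p := j)) //= addrAC subrr add0r.
    by rewrite -big_mkcond.
  by apply: le_trans (ler_normB _ _) _; rewrite [2 * K]mulr_natl mulr2n; apply: lerD; apply: HK.
have wd i : (m <= i)%N -> w i.+1 <= w i.
  move=> mi; have i1 : (1 < i)%N by lia.
  by rewrite lef_pV2 ?posrE ?ln_gt0 ?ltr1n ?(leqW i1) //; apply: ler_ln_nat => //; lia.
have w0 i : (m <= i)%N -> 0 <= w i.
  by move=> mi; rewrite invr_ge0 ln_ge0 // ler1n; lia.
have aw p : (m <= p)%N -> a p * w p = if prime p then g p else 0.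
  move=> mp; rewrite /a; case: ifP => pp; last by rewrite mul0r.
  by rewrite mulrAC /w mulfV ?mul1r // gt_eqF // ln_gt0 // ltr1n; lia.
have gsum : `|\sum_(m <= p < N | prime p) g p| <= 2 * K / ln m%:R.
  have E : \sum_(m <= p < N | prime p) g p = \sum_(m <= p < N) a p * w p.
    by rewrite big_mkcond /= !big_nat; apply: eq_bigr => p /andP[mp _]; rewrite aw.
  rewrite E ler_norml; apply/andP; split; last first.
    apply: (abel_sum_le (D := 2 * K) (ltnW mN) _ wd w0) => j mj.
    by have := aK j mj; rewrite ler_norml => /andP[].
  rewrite lerNl -sumrN; under eq_bigr => p _ do rewrite -mulNr.
  apply: (abel_sum_le (a := fun p => - a p) (D := 2 * K) (ltnW mN) _ wd w0) => j mj.
  by rewrite sumrN lerNl; have := aK j mj; rewrite ler_norml => /andP[].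
have esum : `|\sum_(m <= p < N | prime p) (ln (local_factor R F p) + g p)| <= 2 * D / ln m%:R.
  apply: le_trans (ler_norm_sum _ _ _) _.
  apply: (@le_trans _ _ (\sum_(m <= p < N) D * (p%:R ^+ 2)^-1)).
    rewrite big_mkcond /= big_nat [leRHS]big_nat; apply: ler_sum => p /andP[mp _].
    case: ifP => pp; last by rewrite mulr_ge0 // invr_ge0 exprn_ge0.
    by have [] := near p pp (leq_trans m0m mp).
  rewrite -mulr_sumr (_ : 2 * D / ln m%:R = D * (2 / ln m%:R)); last by ring.
  apply: ler_wpM2l => //.
  apply: le_trans (sum_inv_sqr_le R N (ltnW m1')) _.
  apply: ler_wpM2l => //; rewrite lef_pV2 ?posrE ?ltr0n ?(ltnW m1') //.
  apply: le_trans (ln_le_subr1 _) _; rewrite ?ltr0n ?(ltnW m1') //.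
  by rewrite gerBl.
have -> : \sum_(m <= p < N | prime p) ln (local_factor R F p) =
    \sum_(m <= p < N | prime p) (ln (local_factor R F p) + g p) -
    \sum_(m <= p < N | prime p) g p.
  by rewrite -sumrB; apply: eq_bigr => p _; rewrite addrK.
apply: le_trans (ler_normB _ _) _.
have il : 0 <= (ln m%:R)^-1 :> R by rewrite invr_ge0 ltW.
have -> : (2 * K + 2 * D + 1) / ln m%:R = 2 * D / ln m%:R + 2 * K / ln m%:R + (ln m%:R)^-1 by ring.
by move: esum gsum; move: (2 * D / _) (2 * K / _) => u v; lra.
Qed.

Lemma tail_limit (R : realType) (k : nat) (F : 'I_k -> {poly int}) (m0 : nat)
    (C : R) (q : R) :
  (2 <= m0)%N -> 0 < C ->
  (forall p, prime p -> (m0 <= p)%N -> 0 < local_factor R F p) ->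
  (forall m N, (m0 <= m)%N ->
      `|\sum_(m <= p < N | prime p) ln (local_factor R F p)| <= C / ln m%:R) ->
  m0%:R <= q ->
  exists l : R, [/\ tail_log_sum F q x @[x --> \oo] --> l,
    tail_prod F q x @[x --> \oo] --> expR l & `|l| <= C / ln q].
Proof.
move=> m2 C0 Lpos Ltail qm.
have q2 : 2 <= q by apply: le_trans qm; rewrite ler_nat.
have q0 : 0 <= q by lra.
have /andP[tq qt] := truncn_itv q0.
pose m := (Num.truncn q).+1.
have qp p : (q < p%:R) = (m <= p)%N.
  apply/idP/idP => [qp|mp]; last by apply: lt_le_trans qt _; rewrite ler_nat.
  by rewrite /m -(ltr_nat R); apply: le_lt_trans qp.
have m0m : (m0 <= m)%N.
  by apply: ltnW; rewrite -(ltr_nat R); apply: le_lt_trans qm qt.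
pose u p : R := if prime p && (q < p%:R) then ln (local_factor R F p) else 0.
have usum a b : (m <= a)%N -> \sum_(a <= p < b) u p =
    \sum_(a <= p < b | prime p) ln (local_factor R F p).
  move=> ma; rewrite [RHS]big_mkcond /= !big_nat; apply: eq_bigr => p /andP[ap _].
  by rewrite /u qp (leq_trans ma ap) andbT.
have ub a b : (m <= a)%N -> `|\sum_(a <= p < b) u p| <= C / ln a%:R.
  by move=> ma; rewrite usum //; apply: Ltail; apply: leq_trans ma.
have sE x : tail_log_sum F q x = series u x.+1 by rewrite /tail_log_sum /series /= big_mkcond.
have cu : cvgn (series u).
  apply/cauchy_cvgP/cauchy_seriesP => e e0.
  (* From this index on, [C / ln a] is less than [e]. *)
  pose a0 := maxn m (Num.truncn (expR (C / e))).+1.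
  exists ([set n | (a0 <= n)%N], setT).
    by split; [exists a0 | exact: filterT].
  move=> [x y] [/= a0x _].
  have mx : (m <= x)%N by apply: leq_trans a0x; rewrite leq_maxl.
  apply: le_lt_trans (ub _ _ mx) _.
  have ex : expR (C / e) < x%:R.
    have /andP[_ h] := truncn_itv (ltW (expR_gt0 (C / e))).
    apply: lt_le_trans h _; rewrite ler_nat; apply: leq_trans a0x.
    by rewrite leq_maxr.
  have x0 : 0 < x%:R :> R by apply: lt_trans ex; apply: expR_gt0.
  have lx : C / e < ln x%:R.
    by rewrite -[C / e]expRK ltr_ln ?posrE ?expR_gt0.
  have lx0 : 0 < ln x%:R :> R by apply: lt_trans lx; rewrite divr_gt0.
  by rewrite ltr_pdivrMr // mulrC -ltr_pdivrMr.
exists (limn (series u)).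
have logl : tail_log_sum F q x @[x --> \oo] --> limn (series u).
  rewrite (_ : (fun x => tail_log_sum F q x) = (fun x => series u x.+1)); last exact/funext.
  by rewrite cvg_shiftS.
split => //.
  rewrite (_ : (fun x => tail_prod F q x) = (fun x => expR (tail_log_sum F q x))).
    by apply: (continuous_cvg _ _ logl); apply: continuous_expR.
  apply/funext => x; rewrite /tail_prod /tail_log_sum (big_morph expR (@expRD R) (@expR0 R)).
  apply: eq_bigr => p /andP[pp]; rewrite qp => mp.
  by rewrite lnK // posrE; apply: Lpos => //; apply: leq_trans mp.
have lq : 0 < ln q by rewrite ln_gt0 //; lra.
have bnd n : `|series u n| <= C / ln q.
  have [nm|mn] := leqP n m.
    rewrite /series /= big_nat big1 ?normr0 ?divr_ge0 ?ltW // => p /andP[_ pn].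
    by rewrite /u qp leqNgt (leq_trans pn nm) andbF.
  rewrite /series /= (big_cat_nat (n := m)) //=; last exact: ltnW.
  rewrite big_nat big1 ?add0r; last by move=> p /andP[_ pn]; rewrite /u qp leqNgt pn andbF.
  apply: le_trans (ub _ _ (leqnn m)) _; apply: ler_wpM2l; first exact: ltW.
  have qm' : q <= m%:R by apply: ltW.
  have lnqm : ln q <= ln m%:R by rewrite ler_ln ?posrE //; lra.
  by rewrite lef_pV2 ?posrE //; apply: lt_le_trans lnqm.
have cn : `|series u x| @[x --> \oo] --> `|limn (series u)| by apply: cvg_norm cu.
rewrite -(cvg_lim (@norm_hausdorff _ _) cn); apply: limr_le; first by apply/cvg_ex; exists `|limn (series u)|.
by near=> n; apply: bnd.
Unshelve. all: by end_near.
Qed.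

Theorem theorem3p1 (R : realType) (k : nat) (F : 'I_k -> {poly int})
  (F_deg : forall i, (1 <= (size (F i)).-1)%N)
  (F_irr : forall i, irreducible_poly (map_poly intr (F i) : {poly rat}))
  (F_simple : forall i (z : algC),
     root (map_poly intr (F i)) z -> mup z (map_poly intr (F i)) = 1%N)
  (F_roots : [set z : algC | root (map_poly intr (\prod_(i < k) F i)) z]
     #= `I_(\sum_(i < k) (size (F i)).-1)) :
  (\forall q \near +oo_R,
     [/\ forall p : nat, prime p -> q < p%:R -> 0 < local_factor R F p,
         cvgn (tail_prod F q),
         0 < tail F q
       & tail_log_sum F q x @[x --> \oo] --> ln (tail F q)]) /\
  (fun q : R => ln (tail F q)) =O_ (+oo_R) (fun q : R => (ln q)^-1).
Proof.
have F_cop := system_coprime F_deg F_roots.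
have [m0 [C [m2 C0 Lpos Ltail]]] := local_factor_tail R F_deg F_irr F_cop.
have tailE q : m0%:R <= q -> exists l : R, [/\ tail_log_sum F q x @[x --> \oo] --> l,
    tail_prod F q x @[x --> \oo] --> expR l, tail F q = expR l & `|l| <= C / ln q].
  move=> qm; have [l [h1 h2 h3]] := tail_limit m2 C0 Lpos Ltail qm.
  by exists l; split => //; apply: cvg_lim h2; apply: norm_hausdorff.
split.
  exists m0%:R; split; first exact: num_real.
  move=> q /ltW qm; have [l [h1 h2 h3 h4]] := tailE q qm; split.
  - move=> p pp qp; apply: Lpos => //.
    by rewrite -(ler_nat R); apply: le_trans qm (ltW qp).
  - by apply/cvg_ex; exists (expR l).
  - by rewrite h3 expR_gt0.
  - by rewrite h3 expRK.
apply/eqO_exP; exists C => //.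
exists m0%:R; split; first exact: num_real.
move=> q /ltW qm; have [l [_ _ -> h4]] := tailE q qm.
rewrite expRK; apply: le_trans h4 _; apply: ler_wpM2l; first exact: ltW.
exact: ler_norm.
Qed.
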